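(* Let $0 \le \alpha < 1$. There is a constant $C = C(\alpha)$ such that for every set $P$ of $n$ points in real affine space $\mathbb{R}^d$ (any $d$) and every $r \ge 1$, the number of $3$-flats that are both $r$-rich and $\alpha$-degenerate (with respect to $P$) is at most $C\left(n^{4} r^{-5} + n^3 r^{-3}\right)$.
   Context: A $k$-flat is a $k$-dimensional affine subspace. A $3$-flat $\Gamma$ is $r$-rich if it contains at least $r$ points of $P$. A $3$-flat $\Gamma$ is $\alpha$-degenerate if every $2$-flat (plane) contained in $\Gamma$ contains at most $\alpha |P \cap \Gamma|$ points of $P$. *)

(* Defs.v *)
From HB Require Import structures.
From mathcomp Require Import all_boot all_order all_algebra.
From mathcomp Require Import finmap.
From mathcomp Require Import all_classical all_reals.

Set Implicit Arguments.
Unset Strict Implicit.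
Unset Printing Implicit Defensive.

Import Order.TTheory GRing.Theory Num.Theory.

Local Open Scope fset_scope.
Local Open Scope classical_set_scope.
Local Open Scope ring_scope.

Definition is_flat (R : realType) (d k : nat) (F : set 'rV[R]_d) : Prop :=
  exists (p : 'rV[R]_d) (U : {vspace 'rV[R]_d}),
    (\dim U = k)%N /\ F = [set x | x - p \in U].

Definition npts (R : realType) (d : nat) (P : {fset 'rV[R]_d})
    (F : set 'rV[R]_d) : nat :=
  #|` [fset x in P | x \in F] |.

Definition rich (R : realType) (d : nat) (P : {fset 'rV[R]_d}) (r : R)
    (F : set 'rV[R]_d) : Prop :=
  r <= (npts P F)%:R.

(* A non-concentration condition, despite the name. *)
Definition degenerate (R : realType) (d : nat) (P : {fset 'rV[R]_d})
    (alpha : R) (F : set 'rV[R]_d) : Prop :=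
  forall G : set 'rV[R]_d, is_flat 2 G -> G `<=` F ->
    (npts P G)%:R <= alpha * (npts P F)%:R.

Definition rich_degenerate_3flats (R : realType) (d : nat)
    (P : {fset 'rV[R]_d}) (r alpha : R) : set (set 'rV[R]_d) :=
  [set F | [/\ is_flat 3 F, rich P r F & degenerate P alpha F]].

(* Main.v *)
(** The number of 3-flats is bounded by double counting pairs (p, q) of points
    that are "wide" in a flat F: those for which projecting from the line pq
    sends the points of F to at least k * |F| distinct points. Projecting from a
    fixed line pq turns the flats through it into lines of a projective plane, so
    Szemeredi-Trotter bounds the number of flats in which (p, q) is wide by
    O(n^2/r^3 + n/r); summing over n^2 pairs and dividing by the Omega(r^2) wide
    pairs of each flat gives O(n^4/r^5 + n^3/r^3).

    That a non-concentrated set of m points in 3-space has Omega(m^2) wide pairs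
    is shown in three cases. If some line L carries a positive fraction of the
    points, then a pair (q, s) for which L, q, s span the space is wide, because
    the points of L have distinct projections. If no line is rich but a plane H
    is, Beck's theorem in H gives many points s of H seeing many directions, and
    (s, p) is wide for p off H. If no plane is rich, Beck's theorem is applied
    twice, the second time to the projection from a point.

    Szemeredi-Trotter is derived from the crossing lemma. Flats are handled as
    linear spans of the points (1, x), which makes projection from a point or a
    line the quotient by a subspace. *)

Require Import Defs.
From HB Require Import structures.
From mathcomp Require Import all_boot all_order all_algebra.
From mathcomp Require Import boolp.
From mathcomp Require Import ring lra zify.

Set Implicit Arguments.
Unset Strict Implicit.
Unset Printing Implicit Defensive.

Import Order.TTheory GRing.Theory Num.Theory.

Local Open Scope ring_scope.

(** * Crossing lemma *)

Section PlaneGraph.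
Variables (R : realFieldType) (V : finType) (x y : V -> R).
Hypothesis x_inj : injective x.

Definition slope (e : V * V) : R := (y e.2 - y e.1) / (x e.2 - x e.1).
Definition height (e : V * V) (t : R) : R := y e.1 + slope e * (t - x e.1).

Definition crossing (e f : V * V) : bool :=
  `[< exists t, [/\ x e.1 < t < x e.2, x f.1 < t < x f.2
      & height e t = height f t] >].

Lemma height_start e : height e (x e.1) = y e.1.
Proof. by rewrite /height subrr mulr0 addr0. Qed.

Lemma height_end e : x e.1 < x e.2 -> height e (x e.2) = y e.2.
Proof. by move=> h; rewrite /height /slope mulfVK ?subr_eq0 ?gt_eqF //; lra. Qed.

(** Otherwise the difference of the two heights, an affine function, would change sign between [a]
    and [b], and its zero [t] would be a crossing. *)
Lemma not_crossing_order e f a b :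
    ~~ crossing e f -> x e.1 <= a -> x f.1 <= a -> a < b ->
    b <= x e.2 -> b <= x f.2 -> height e b < height f b ->
  height e a <= height f a.
Proof.
move=> /asboolPn nc ea fa ab be bf hb; rewrite leNgt; apply/negP => ha.
apply: nc.
move: ha hb; rewrite /height.
set se := slope e; set sf := slope f; move=> ha hb.
have hs : se - sf < 0.
  rewrite ltNge; apply/negP => hs.
  have := mulr_ge0 hs (ltW (eqbRL (subr_gt0 _ _) ab)); lra.
pose c := y e.1 - se * x e.1 - (y f.1 - sf * x f.1).
pose t := - c / (se - sf).
have tE : (se - sf) * t = - c by rewrite /t mulrC mulfVK // lt_eqF.
have at_ : a < t.
  rewrite ltNge; apply/negP => h.
  have := mulr_le0_ge0 (ltW hs) (eqbRL (subr_ge0 _ _) h); rewrite mulrBr tE /c; lra.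
have tb : t < b.
  rewrite ltNge; apply/negP => h.
  have := mulr_le0_ge0 (ltW hs) (eqbRL (subr_ge0 _ _) h); rewrite mulrBr tE /c; lra.
exists t; split.
- by apply/andP; split; lra.
- by apply/andP; split; lra.
- by move: tE; rewrite /c; lra.
Qed.

(** * Edge bound for graphs drawn without crossings *)

Section Noncrossing.
Variables (W : {set V}) (E : {set V * V}).
Hypothesis E_W : forall e, e \in E -> (e.1 \in W) && (e.2 \in W).
Hypothesis E_lt : forall e, e \in E -> x e.1 < x e.2.
Hypothesis E_avoid : forall e w, e \in E -> w \in W ->
  x e.1 < x w < x e.2 -> y w != height e (x w).
Hypothesis E_nc : forall e f, e \in E -> f \in E -> e != f -> ~~ crossing e f.

Let in_wedge (e e2 : V * V) (w : V) : bool :=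
  [&& w \in W, x e.1 < x w, x w <= x e.2, x w <= x e2.2,
      height e (x w) <= y w & y w <= height e2 (x w)].

(** [e2] is the next steeper edge at the apex [e.1], and [w] is the leftmost vertex of the closed
    region between the two edges, cut off at the nearer right end. That end lies in the region, so
    such a [w] exists. *)
Let wedge (e e2 : V * V) (w : V) : Prop :=
  [/\ e \in E /\ e2 \in E, e2.1 = e.1, slope e < slope e2,
      (forall f, f \in E -> f.1 = e.1 -> slope e < slope f ->
         slope e2 <= slope f)
    & in_wedge e e2 w /\ forall z, in_wedge e e2 z -> x w <= x z].

(** An overlap counts as a crossing, and distinct edges of equal slope leaving the same vertex would
    overlap near it. *)
Let slope_inj e f : e \in E -> f \in E -> e.1 = f.1 -> slope e = slope f -> e = f.
Proof.
move=> eE fE ef1 s; apply/eqP; apply/negPn/negP => /(E_nc eE fE) /asboolPn[].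
have he := E_lt eE; have hf := E_lt fE.
pose t := x e.1 + Num.min (x e.2 - x e.1) (x f.2 - x f.1) / 2.
have hm : 0 < Num.min (x e.2 - x e.1) (x f.2 - x f.1).
  by rewrite lt_min !subr_gt0 he hf.
have h1 : Num.min (x e.2 - x e.1) (x f.2 - x f.1) <= x e.2 - x e.1.
  by rewrite ge_min lexx.
have h2 : Num.min (x e.2 - x e.1) (x f.2 - x f.1) <= x f.2 - x f.1.
  by rewrite ge_min lexx orbT.
exists t; rewrite /t /height -ef1 s; rewrite -ef1 in h1 h2 hm *.
by split=> //; apply/andP; split; lra.
Qed.

Let wedge_ex e f : e \in E -> f \in E -> f.1 = e.1 -> slope e < slope f ->
  exists e2 w, wedge e e2 w.
Proof.
move=> eE fE fe sf.
pose P (g : V * V) := [&& g \in E, g.1 == e.1 & slope e < slope g].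
have Pf : P f by rewrite /P fE fe eqxx sf.
case: (Order.TotalTheory.arg_minP slope Pf) => e2 /and3P[e2E /eqP e21 se2] min2.
have he := E_lt eE; have he2 := E_lt e2E.
have [w0 Pw0] : exists w, in_wedge e e2 w.
  have [le|lt] := lerP (x e.2) (x e2.2).
    exists e.2; rewrite /in_wedge (andP (E_W eE)).2 he lexx le height_end // lexx /=.
    rewrite -height_end // /height e21 lerD2l ler_wpM2r //; lra.
  exists e2.2; rewrite /in_wedge (andP (E_W e2E)).2 (height_end he2) !lexx (ltW lt) -e21 he2 /=.
  rewrite andbT -(height_end he2) /height e21 lerD2l ler_wpM2r //; last exact: ltW.
  by rewrite -e21; lra.
case: (Order.TotalTheory.arg_minP x Pw0) => w Pw minw.
exists e2, w; split=> // g gE ge sg.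
by apply: min2; rewrite /P gE ge eqxx sg.
Qed.

Let wedge_on e e2 w : wedge e e2 w -> y w = height e (x w) -> w = e.2.
Proof.
move=> [[eE _] _ _ _ [/and5P[wW h1 h2 _ _] _]] yw.
apply: x_inj; apply/eqP; move: h2; rewrite le_eqVlt => /orP[//|h2].
by have := E_avoid eE wW; rewrite h1 h2 yw eqxx => /(_ isT).
Qed.

(** A less steep edge [e'] ending at [w] would run above [e] to the left of [w] and, not crossing
    [e2], below [e2]. Then its left end lies in the wedge before [w], or it reaches back to the
    apex, where [e] and [e2] leave no room. *)
Let wedge_below e e2 w e' : wedge e e2 w -> w = e.2 ->
  e' \in E -> e'.2 = w -> slope e <= slope e'.
Proof.
move=> [[eE e2E] e21 s12 nxt [/and5P[wW h1 h2 h3 /andP[h4 h5]] minw]] we e'E e'w.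
rewrite leNgt; apply/negP => slt.
have he := E_lt eE; have he2 := E_lt e2E; have he' := E_lt e'E.
have e'e : e' != e by apply: contraTneq slt => ->; rewrite ltxx.
have yw : height e (x w) = y w by rewrite we height_end.
have yw' : height e' (x w) = y w by rewrite -e'w height_end.
have e'lt t : t < x w -> height e t < height e' t.
  move=> tw; move: yw; rewrite -yw' => /esym.
  have := mulr_gt0 (eqbRL (subr_gt0 _ _) slt) (eqbRL (subr_gt0 _ _) tw).
  by rewrite /height; lra.
have ee2 : height e (x w) < height e2 (x w).
  rewrite /height e21 ltrD2l ltr_pM2r //; lra.
have e'e2 : height e' (x w) < height e2 (x w).
  by rewrite yw' -yw.
have e2e' : e' != e2 by apply: contraTneq e'e2 => ->; rewrite ltxx.
have nc := E_nc e'E e2E e2e'.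
have [lt|lt|eq] := ltgtP (x e.1) (x e'.1).
- have vw : x e'.1 < x w by rewrite -e'w.
  have le2 : y e'.1 <= height e2 (x e'.1).
    rewrite -height_start; apply: (not_crossing_order (b := x w) nc) => //.
    + by rewrite e21 ltW.
    + by rewrite e'w.
  have /minw : in_wedge e e2 e'.1.
    rewrite /in_wedge (andP (E_W e'E)).1 lt le2 /= -height_start (ltW (e'lt _ vw)) /=.
    by rewrite (le_trans (ltW vw) h2) (le_trans (ltW vw) h3).
  by rewrite leNgt vw.
- have : height e' (x e.1) <= height e2 (x e.1).
    apply: (not_crossing_order (b := x w) nc) => //.
    + exact: ltW.
    + by rewrite e21.
    + by rewrite e'w.
  have := e'lt _ h1; rewrite height_start -{3}e21 -{3}e21.
  by rewrite height_start e21 => a b; move: (lt_le_trans a b); rewrite ltxx.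
- have : e = e' by rewrite [e]surjective_pairing [e']surjective_pairing -we e'w (x_inj eq).
  by move=> ee; rewrite ee eqxx in e'e.
Qed.

(** Different wedges at a common apex share no point strictly above both lower edges. If the apexes
    differ, the later one lies in the first wedge, against the choice of [w]; or below [e], so that
    [e2'] must cross [e]; or above [e2], so that [e'] must cross [e2]. *)
Let wedge_above e e2 w e' e2' : wedge e e2 w -> wedge e' e2' w ->
  height e (x w) < y w -> height e' (x w) < y w -> x e.1 <= x e'.1 -> e = e'.
Proof.
move=> [[eE e2E] e21 s12 nxt [/and5P[wW h1 h2 h3 /andP[h4 h5]] minw]].
move=> [[e'E e2'E] e21' s12' nxt' [/and5P[_ h1' h2' h3' /andP[h4' h5']] _]] a a'.
rewrite le_eqVlt => /orP[/eqP/x_inj ee|lt].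
  apply: (slope_inj eE e'E ee); apply/eqP; rewrite eq_le !leNgt.
  apply/andP; split; apply/negP => sl.
    have := nxt' _ eE ee sl => sl2.
    have : height e2' (x w) <= height e (x w).
      by rewrite /height e21' -ee lerD2l ler_wpM2r //; lra.
    by lra.
  have := nxt _ e'E (esym ee) sl => sl2.
  have : height e2 (x w) <= height e' (x w).
    by rewrite /height e21 ee lerD2l ler_wpM2r //; lra.
  by lra.
exfalso.
have [le|gt] := lerP (y e'.1) (height e2 (x e'.1)).
  have [le'|gt'] := lerP (height e (x e'.1)) (y e'.1).
    have /minw : in_wedge e e2 e'.1.
      by rewrite /in_wedge (andP (E_W e'E)).1 lt le le' (le_trans (ltW h1') h2) (le_trans (ltW h1') h3).
    by rewrite leNgt h1'.
  have ne : e != e2'.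
    by apply: contraTneq lt => ->; rewrite e21' ltxx.
  have : height e (x e'.1) <= height e2' (x e'.1).
    apply: (not_crossing_order (b := x w) (E_nc eE e2'E ne)) => //.
    + exact: ltW.
    + by rewrite e21'.
    + lra.
  by rewrite -{2}e21' height_start e21'; lra.
have ne : e' != e2 by apply: contraTneq lt => ->; rewrite e21 ltxx.
have : height e' (x e'.1) <= height e2 (x e'.1).
  apply: (not_crossing_order (b := x w) (E_nc e'E e2E ne)) => //.
  + by rewrite e21 ltW.
  + lra.
by rewrite height_start; lra.
Qed.

Let wedge_inj e e2 e' e2' w : wedge e e2 w -> wedge e' e2' w ->
  (y w == height e (x w)) = (y w == height e' (x w)) -> e = e'.
Proof.
move=> h h'.
have [eE e'E] : e \in E /\ e' \in E by case: h => -[? _] _ _ _ _; case: h' => -[? _].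
have [/eqP on|non] := boolP (y w == height e (x w)) => /esym.
  move/eqP => on'.
  have we := wedge_on h on; have we' := wedge_on h' on'.
  have s : slope e = slope e'.
    apply/eqP; rewrite eq_le (wedge_below h we e'E (esym we')).
    by rewrite (wedge_below h' we' eE (esym we)).
  have he := E_lt eE; have he' := E_lt e'E.
  apply/eqP/negPn/negP => /(E_nc eE e'E) /asboolPn[].
  (* Two edges of equal slope ending at [w] overlap halfway between [w] and the later left end. *)
  pose t := Num.max (x e.1) (x e'.1) / 2 + x w / 2.
  have m1 : x e.1 <= Num.max (x e.1) (x e'.1) by rewrite le_max lexx.
  have m2 : x e'.1 <= Num.max (x e.1) (x e'.1) by rewrite le_max lexx orbT.
  have m3 : Num.max (x e.1) (x e'.1) < x w by rewrite gt_max {1}we {1}we' he he'.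
  exists t; rewrite /t; split.
  - by apply/andP; split; rewrite -?we; lra.
  - by apply/andP; split; rewrite -?we'; lra.
  - by move: on on'; rewrite /height s; lra.
move/negbT => non'.
have lt f f2 : wedge f f2 w -> y w != height f (x w) -> height f (x w) < y w.
  by move=> [_ _ _ _ [/and5P[_ _ _ _ /andP[l _]] _]] n; rewrite lt_neqAle eq_sym n.
have [le|le] := lerP (x e.1) (x e'.1).
  exact: (wedge_above h h' (lt _ _ h non) (lt _ _ h' non')).
by apply/esym/(wedge_above h' h (lt _ _ h' non') (lt _ _ h non)); apply: ltW.
Qed.

(* Every edge e that is not the steepest one leaving its left endpoint v to the
   right opens a wedge at v, bounded above by the next steeper edge e2. Sweeping
   to the right, the first vertex w met by the wedge, together with the
   information whether w is the end of e, determines e. *)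
Lemma noncrossing_card : (#|E| <= 3 * #|W|)%N.
Proof.
pose nontop e := [exists f in E, (f.1 == e.1) && (slope e < slope f)].
(* An edge that is not the steepest at its left end is charged to its vertex [w] and one bit, which
   allows [2 * #|W|] values; the steepest edges are charged to their left ends. *)
rewrite -(cardsID [set e | nontop e] E) -[3%N]/(2 + 1)%N mulnDl mul1n leq_add //.
  have wit e : {p : (V * V) * V | e \in E -> nontop e -> wedge e p.1 p.2}.
    apply: cid; have [/andP[eE /exists_inP[f fE /andP[/eqP fe sf]]]|] :=
      boolP ((e \in E) && nontop e).
      by have [e2 [w h]] := wedge_ex eE fE fe sf; exists (e2, w).
    by case: (e \in E); case: (nontop e) => // _; exists ((e.1, e.1), e.1).
  pose F e := let w := (sval (wit e)).2 in (w, y w == height e (x w)).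
  have Fin : {in E :&: [set e | nontop e] &, injective F}.
    move=> e e'; rewrite !inE => /andP[eE ne] /andP[e'E ne'].
    rewrite /F; have := svalP (wit e) eE ne; have := svalP (wit e') e'E ne'.
    move: (sval (wit e)) (sval (wit e')) => p p' /= h' h [w hw].
    rewrite -w in h' hw; exact: (wedge_inj h h' hw).
  rewrite -(card_in_imset Fin).
  have <- : #|setX W [set: bool]| = (2 * #|W|)%N.
    by rewrite cardsX cardsT card_bool mulnC.
  apply: subset_leq_card; apply/subsetP => _ /imsetP[e + ->].
  rewrite !inE => /andP[eE ne].
  by have [_ _ _ _ [/andP[]]] := svalP (wit e) eE ne; rewrite andbT.
have Fin : {in E :\: [set e | nontop e] &, injective (fun e => e.1)}.
  move=> e f; rewrite !inE => /andP[/exists_inPn ne eE] /andP[/exists_inPn nf fE] ef.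
  apply: slope_inj => //; apply/eqP; rewrite eq_le !leNgt.
  by move: (ne _ fE) (nf _ eE); rewrite ef eqxx /= => -> ->.
rewrite -(card_in_imset Fin); apply: subset_leq_card.
by apply/subsetP => _ /imsetP[e /setDP[eE _] ->]; case/andP: (E_W eE).
Qed.

End Noncrossing.
End PlaneGraph.

(** * Averaging over random vertex sets *)

(** A uniform map vanishes on [A] with probability [1 / k.+1 ^ #|A|]; the identity is multiplied out
    to stay in the natural numbers. *)
Lemma card_vanishing_ffun (V : finType) (k : nat) (A : {set V}) :
  (k.+1 ^ #|A| * #|[set phi : {ffun V -> 'I_k.+1} |
                     A \subset [set v | phi v == ord0]]| = k.+1 ^ #|V|)%N.
Proof.
pose F v := if v \in A then pred1 (ord0 : 'I_k.+1) else predT.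
have -> : #|[set phi : {ffun V -> 'I_k.+1} | A \subset [set v | phi v == ord0]]|
          = #|(family F : simpl_pred {ffun V -> 'I_k.+1})|.
  apply: eq_card => phi; rewrite inE; apply/subsetP/familyP => [h v|h v vA].
    by rewrite /F; case: ifP => // /h; rewrite !inE.
  by have := h v; rewrite /F vA !inE.
rewrite card_family foldrE big_map big_enum /= (bigID (mem A)) /=.
rewrite big1 ?mul1n; last by move=> v vA; rewrite /F vA card1.
rewrite (eq_bigr (fun=> k.+1)); last first.
  by move=> v /negbTE vA; rewrite /F vA card_ord.
rewrite prod_nat_const -expnD; congr (_ ^ _)%N.
by rewrite -(cardC A); congr (_ + _)%N; apply: eq_card => v; rewrite !inE.
Qed.

(** Linearity of expectation: an object supported on [a] vertices survives with probability
    [1 / k.+1 ^ a]. *)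
Lemma sum_card_vanishing (V T : finType) (k a : nat) (S : {set T})
    (supp : T -> {set V}) : (forall t, t \in S -> #|supp t| = a) ->
  (k.+1 ^ a * \sum_(phi : {ffun V -> 'I_k.+1})
     #|[set t in S | supp t \subset [set v | phi v == ord0]]|
   = #|S| * k.+1 ^ #|V|)%N.
Proof.
move=> suppa.
have -> : (\sum_(phi : {ffun V -> 'I_k.+1})
     #|[set t in S | supp t \subset [set v | phi v == ord0]]|
   = \sum_(t in S) #|[set phi : {ffun V -> 'I_k.+1} |
                     supp t \subset [set v | phi v == ord0]]|)%N.
  rewrite (eq_bigr (fun phi : {ffun V -> 'I_k.+1} => \sum_(t in S)
    if supp t \subset [set v | phi v == ord0] then 1 else 0)%N); last first.
    by move=> phi _; rewrite -sum1_card -big_mkcondr; apply: eq_bigl => t; rewrite inE.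
  rewrite exchange_big; apply: eq_bigr => t _ /=.
  by rewrite -sum1_card [RHS]big_mkcond; apply: eq_bigr => phi _; rewrite inE.
rewrite big_distrr /= -sum_nat_const; apply: eq_bigr => t tS.
by rewrite -(suppa t tS) card_vanishing_ffun.
Qed.

Section CrossingLemma.
Variables (R : realFieldType) (V : finType) (x y : V -> R).
Hypothesis x_inj : injective x.

(** Ordered pairs, so that each crossing is counted twice. *)
Definition crossings (E : {set V * V}) : {set (V * V) * (V * V)} :=
  [set p | [&& p.1 \in E, p.2 \in E, p.1 != p.2 & crossing x y p.1 p.2]].

(** Deleting an edge of a crossing pair lowers the number of crossings by at least one; once none is
    left, [noncrossing_card] applies. *)
Lemma crossings_lower_bound (W : {set V}) (E : {set V * V}) :
    (forall e, e \in E -> (e.1 \in W) && (e.2 \in W)) ->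
    (forall e, e \in E -> x e.1 < x e.2) ->
    (forall e w, e \in E -> w \in W -> x e.1 < x w < x e.2 ->
       y w != height x y e (x w)) ->
  (#|E| <= 3 * #|W| + #|crossings E|)%N.
Proof.
elim: {E}#|E| {-2}E (erefl #|E|) => [|n IHn] E En EW Elt Eav; first by rewrite En.
have [X0|[[e f]]] := set_0Vmem (crossings E).
  rewrite X0 cards0 addn0; apply: (noncrossing_card x_inj EW Elt Eav).
  move=> e f eE fE ef; apply/negP => cef.
  by have := in_set0 (e, f); rewrite -X0 inE /= eE fE ef cef.
rewrite inE /= => /and4P[eE fE ef cef].
have En' : #|E :\ e| = n by move: En; rewrite (cardsD1 e) eE => -[].
have sub := subsetP (subD1set E e).
have := IHn _ En' (fun g h => EW g (sub g h)) (fun g h => Elt g (sub g h))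
  (fun g w h => Eav g w (sub g h)).
have : (#|crossings (E :\ e)| < #|crossings E|)%N.
  apply: proper_card; apply/properP; split.
    apply/subsetP => p; rewrite !inE.
    by move=> /and4P[/andP[_ ->] /andP[_ ->] -> ->].
  by exists (e, f); rewrite !inE /= ?eE ?fE ?ef ?cef ?eqxx.
by rewrite En' En => lt le; apply: (leq_ltn_trans le); rewrite ltn_add2l.
Qed.

(* Averages [crossings_lower_bound] over the random vertex set on which a
   uniform map V -> {0, ..., k} vanishes. *)
Lemma crossing_lemma (E : {set V * V}) (k : nat) :
    (forall e, e \in E -> x e.1 < x e.2) ->
    (forall e w, e \in E -> x e.1 < x w < x e.2 -> y w != height x y e (x w)) ->
    (forall e f, e \in E -> f \in E -> e != f -> crossing x y e f ->
       uniq [:: e.1; e.2; f.1; f.2]) ->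
  (k.+1 ^ 2 * #|E| <= 3 * k.+1 ^ 3 * #|V| + #|crossings E|)%N.
Proof.
move=> Elt Eav Euniq.
pose W (phi : {ffun V -> 'I_k.+1}) : {set V} := [set v | phi v == ord0].
pose s2 (e : V * V) : {set V} := [set e.1; e.2].
pose s4 (p : (V * V) * (V * V)) : {set V} := s2 p.1 :|: s2 p.2.
have s2E e (S : {set V}) : (s2 e \subset S) = (e.1 \in S) && (e.2 \in S).
  by rewrite /s2 subUset !sub1set.
have key phi : (#|[set e in E | s2 e \subset W phi]| <=
    3 * #|[set v in [set: V] | [set v] \subset W phi]| +
    #|[set p in crossings E | s4 p \subset W phi]|)%N.
  have -> : [set v in [set: V] | [set v] \subset W phi] = W phi.
    by apply/setP => v; rewrite !inE sub1set !inE.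
  apply: leq_trans (crossings_lower_bound (W := W phi) _ _ _) _.
  - by move=> e; rewrite inE s2E => /andP[].
  - by move=> e; rewrite inE => /andP[/Elt].
  - by move=> e w; rewrite inE => /andP[eE _] _; apply: Eav.
  rewrite leq_add2l; apply: subset_leq_card; apply/subsetP => p.
  rewrite !inE /s4 subUset => /and4P[/andP[-> ->] /andP[-> ->] -> ->].
  by [].
have e1 := sum_card_vanishing (T := V) k (a := 1) (S := [set: V])
  (supp := fun v => [set v]) (fun v _ => cards1 v).
have e2 : forall e, e \in E -> #|s2 e| = 2%N.
  by move=> e /Elt; rewrite /s2 cards2; case: eqP => [->|//]; rewrite ltxx.
(* A crossing has four distinct endpoints, so it survives with probability [1 / k.+1 ^ 4], against
   [1 / k.+1 ^ 2] for an edge. *)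
have e4 : forall p, p \in crossings E -> #|s4 p| = 4%N.
  move=> p; rewrite inE => /and4P[h1 h2 h3 h4].
  have /card_uniqP c4 := Euniq _ _ h1 h2 h3 h4.
  rewrite -[RHS]c4; apply: eq_card => v; by rewrite !inE !orbA.
have := sum_card_vanishing k e2; have := sum_card_vanishing k e4.
have := leq_sum (index_enum _) (P := predT) (fun phi _ => key phi).
rewrite big_split /= -big_distrr /=; rewrite cardsT in e1.
move: e1; rewrite /W.
set A1 := (\sum_phi #|_|)%N; set A2 := (\sum_phi #|_|)%N; set A4 := (\sum_phi #|_|)%N.
set K := k.+1; have K0 : (0 < K)%N by [].
clearbody A1 A2 A4 K => E1 le E4 E2.
have N0 : (0 < K ^ #|V|)%N by rewrite expn_gt0 K0.
rewrite -(leq_pmul2r N0) mulnDl -mulnA -E2 -!mulnA -[(#|V| * _)%N]E1 -E4.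
rewrite expn1 !(mulnCA 3).
(* Multiplying the averaged inequality by [K ^ 4] clears all three denominators. *)
have := leq_mul (leqnn (K ^ 4)%N) le.
by rewrite mulnDr !expnS expn0 muln1 -!mulnA.
Qed.

End CrossingLemma.

(** * Szemeredi-Trotter theorem *)

(** Here [n], [E], [X], [L] bound or count vertices, edges, crossings and lines. If [E < 6 n], the
    second term suffices. Otherwise the crossing inequality gives [E ^ 3 <= 288 n ^ 2 L ^ 2], and
    [(L k) ^ 3 <= 8 E ^ 3] yields the first term, with [2304 = 8 * 288]. *)
Lemma rich_line_arithmetic (R : realFieldType) (n E X L : nat) (k : R) :
    0 < k -> (E <= n * n)%N -> (X <= L * L)%N -> L%:R * k <= 2 * E%:R ->
    (forall j, j.+1 ^ 2 * E <= 3 * j.+1 ^ 3 * n + X)%N ->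
  L%:R <= 2304 * (n%:R ^+ 2 / k ^+ 3) + 12 * (n%:R / k).
Proof.
move=> k0 En XL Lk cr.
have n0 : 0 <= n%:R :> R by [].
have t1 : 0 <= 2304 * (n%:R ^+ 2 / k ^+ 3) by rewrite mulr_ge0 // divr_ge0 ?exprn_ge0 // ltW.
have t2 : 0 <= 12 * (n%:R / k) by rewrite mulr_ge0 // divr_ge0 // ltW.
have [lt|ge] := ltnP E (6 * n).
  suff : L%:R <= 12 * (n%:R / k) by lra.
  rewrite mulrA ler_pdivlMr //; apply: le_trans Lk _.
  have : E%:R <= (6 * n)%:R :> R by rewrite ler_nat ltnW.
  by rewrite natrM; lra.
suff : L%:R <= 2304 * (n%:R ^+ 2 / k ^+ 3) by lra.
have [n00|npos] := posnP n.
  have E0 : E = 0%N by move: En; rewrite n00 mul0n leqn0 => /eqP.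
  move: Lk; rewrite E0 mulr0 => Lk; apply: le_trans t1.
  by rewrite leNgt; apply/negP => Lp; have := mulr_gt0 Lp k0; lra.
(* The inverse probability [j.+1] is the integer part of [E / (6 n)], which makes the vertex term at
   most half of the left side. *)
pose j := (E %/ (6 * n)).-1.
have n6 : (0 < 6 * n)%N by rewrite muln_gt0.
have jE : j.+1 = (E %/ (6 * n))%N by rewrite /j prednK // divn_gt0.
have jle : (j.+1 * (6 * n) <= E)%N by rewrite jE leq_trunc_div.
have jge : (E <= 12 * n * j.+1)%N.
  have := ltn_ceil E n6; rewrite -jE; nia.
have crj := cr j.
have h1 : (j.+1 ^ 2 * E <= 2 * (L * L))%N.
  have : (3 * j.+1 ^ 3 * n * 2 <= j.+1 ^ 2 * E)%N.
    have := leq_mul (leqnn (j.+1 ^ 2)%N) jle.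
    by apply: leq_trans; rewrite [(j.+1 ^ 3)%N]expnSr; apply: eq_leq; ring.
  lia.
have h2 : (E ^ 3 <= 288 * n ^ 2 * L ^ 2)%N.
  have : (E ^ 2 <= (12 * n * j.+1) ^ 2)%N by rewrite leq_exp2r.
  have := leq_mul (leqnn (144 * n ^ 2)%N) h1.
  move=> a b; have {}b := leq_mul b (leqnn E).
  rewrite expnSr; apply: leq_trans b _; apply: leq_trans (leq_trans _ a) _.
    by apply: eq_leq; ring.
  by apply: eq_leq; ring.
have [->|Lpos] := posnP L; first exact: t1.
have Lp : 0 < L%:R :> R by rewrite ltr0n.
rewrite mulrA ler_pdivlMr ?exprn_gt0 //.
rewrite -(ler_pM2r (exprn_gt0 2 Lp)).
have h3 : (E%:R ^+ 3 : R) <= 288 * n%:R ^+ 2 * L%:R ^+ 2.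
  by rewrite -!natrX -!natrM ler_nat.
have h4 : (L%:R * k) ^+ 3 <= (2 * E%:R) ^+ 3.
  by rewrite lerXn2r ?nnegrE ?mulr_ge0 // ltW.
rewrite (_ : _ * L%:R ^+ 2 = (L%:R * k) ^+ 3); last by ring.
apply: le_trans h4 _; rewrite exprMn.
by apply: le_trans (ler_wpM2l _ h3) _; [lra | rewrite le_eqVlt; apply/orP; left; apply/eqP; ring].
Qed.

Section SzemerediTrotter.
Variables (R : realFieldType) (V T : finType) (x y : V -> R) (a b : T -> R).
Variable D : {set T}.
Hypothesis x_inj : injective x.
Hypothesis ab_inj : {in D &, forall s t, a s = a t -> b s = b t -> s = t}.

Let on t v := y v == a t * x v + b t.
Let between (e : V * V) v := x e.1 < x v < x e.2.
(** The segments of the line [t] between consecutive points on it. *)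
Let edges t : {set V * V} := [set e | [&& on t e.1, on t e.2, x e.1 < x e.2 &
  [forall v, between e v ==> ~~ on t v]]].
Let graph : {set V * V} := \bigcup_(t in D) edges t.

Let height_on t e : e \in edges t -> forall r, height x y e r = a t * r + b t.
Proof.
rewrite inE => /and4P[/eqP o1 /eqP o2 lt _] r.
rewrite /height /slope o2 o1.
have d : x e.2 - x e.1 != 0 by lra.
by rewrite (_ : _ - _ = a t * (x e.2 - x e.1)) ?mulfK //; ring.
Qed.

Let edges_disjoint t e f r : e \in edges t -> f \in edges t ->
  x e.1 < r < x e.2 -> x f.1 < r < x f.2 -> e = f.
Proof.
have aux e' f' : e' \in edges t -> f' \in edges t ->
    x e'.1 < r < x e'.2 -> x f'.1 < r < x f'.2 ->
    (x e'.1 <= x f'.1) && (x f'.2 <= x e'.2).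
  rewrite !inE => /and4P[o1 o2 lt /forallP nb] /and4P[p1 p2 lt' /forallP nb'].
  move=> /andP[i1 i2] /andP[i3 i4]; apply/andP; split; rewrite leNgt; apply/negP => h.
    by have := nb' e'.1; rewrite /between o1 h (lt_trans i1 i4).
  by have := nb' e'.2; rewrite /between o2 h (lt_trans i3 i2).
move=> eE fE ie jf; have /andP[h1 h2] := aux _ _ eE fE ie jf.
have /andP[h3 h4] := aux _ _ fE eE jf ie.
rewrite [e]surjective_pairing [f]surjective_pairing.
by congr pair; apply/x_inj/eqP; rewrite eq_le ?h1 ?h2 ?h3 ?h4.
Qed.

Let line_unique s t p q : s \in D -> t \in D -> p != q ->
  a s * p + b s = a t * p + b t -> a s * q + b s = a t * q + b t -> s = t.
Proof.
move=> sD tD pq hp hq; have ast : a s = a t.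
  apply/eqP; rewrite -subr_eq0; have : (a s - a t) * (p - q) = 0 by lra.
  by move/eqP; rewrite mulf_eq0 (negbTE (_ : p - q != 0)) ?orbF // subr_eq0.
by apply: ab_inj => //; move: hp; rewrite ast => /addrI.
Qed.

Let edges_unique s t e : s \in D -> t \in D -> e \in edges s -> e \in edges t -> s = t.
Proof.
move=> sD tD es et; have := es; rewrite inE => /and4P[_ _ lt _].
apply: (line_unique (p := x e.1) (q := x e.2)) => //; first by rewrite lt_eqF.
- by rewrite -(height_on es) -(height_on et).
- by rewrite -(height_on es) -(height_on et).
Qed.

Let graphP e : reflect (exists2 t, t \in D & e \in edges t) (e \in graph).
Proof. exact: bigcupP. Qed.

Let crossing_lines s t e f : s \in D -> t \in D -> e \in edges s -> f \in edges t ->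
  e != f -> crossing x y e f -> s != t.
Proof.
move=> sD tD es ft ef /asboolP[r [i1 i2 _]]; apply: contraNneq ef => st.
by apply/eqP; apply: (edges_disjoint (t := t) (r := r)) => //; rewrite -st.
Qed.

(** A crossing is determined by its ordered pair of lines: these differ, meet at a single abscissa,
    and each has at most one edge over it. *)
Let graph_crossings : (#|crossings x y graph| <= #|D| * #|D|)%N.
Proof.
have [->|[p0 p0X]] := set_0Vmem (crossings x y graph); first by rewrite cards0.
have [t0 _ _] : exists2 t, t \in D & p0.1 \in edges t.
  by apply/graphP; move: p0X; rewrite inE => /andP[].
have [L LP] : {L : V * V -> T & forall e, e \in graph -> L e \in D /\ e \in edges (L e)}.
  apply: (@choice _ _ (fun e t => e \in graph -> t \in D /\ e \in edges t)) => e.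
  have [/graphP[t tD et]|_] := boolP (e \in graph); first by exists t.
  by exists t0.
pose F (p : (V * V) * (V * V)) := (L p.1, L p.2).
have Finj : {in crossings x y graph &, injective F}.
  move=> [e f] [e' f']; rewrite !inE /= => /and4P[eG fG ef cef] /and4P[eG' fG' ef' cef'].
  move=> [Le Lf]; have [[D1 E1] [D2 E2]] := (LP _ eG, LP _ fG).
  have [[D1' E1'] [D2' E2']] := (LP _ eG', LP _ fG').
  have ne := crossing_lines D1 D2 E1 E2 ef cef.
  move: cef cef' => /asboolP[r [i1 i2 h]] /asboolP[r' [i1' i2' h']].
  have rr : r = r'.
    apply/eqP/negPn/negP => nr; move/negP: ne; apply; apply/eqP.
    apply: (line_unique D1 D2 nr).
      by rewrite -(height_on E1) -(height_on E2).
    by rewrite Le Lf -(height_on E1') -(height_on E2').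
  rewrite -rr in i1' i2'; rewrite -Le in E1'; rewrite -Lf in E2'.
  by rewrite (edges_disjoint E1 E1' i1 i1') (edges_disjoint E2 E2' i2 i2').
rewrite -(card_in_imset Finj) -cardsX; apply: subset_leq_card.
apply/subsetP => _ /imsetP[[e f] + ->]; rewrite !inE /= => /and4P[eG fG _ _].
by rewrite (LP _ eG).1 (LP _ fG).1.
Qed.

(** A common endpoint of the two edges would be the only meeting point of their lines, which lies
    strictly inside both edges. *)
Let graph_uniq e f : e \in graph -> f \in graph -> e != f -> crossing x y e f ->
  uniq [:: e.1; e.2; f.1; f.2].
Proof.
move=> /graphP[s sD es] /graphP[t tD ft] ef cef.
have st := crossing_lines sD tD es ft ef cef.
have eq1 v : on s v -> on t v -> a s * x v + b s = a t * x v + b t.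
  by move=> /eqP <- /eqP <-.
move: cef => /asboolP[r [/andP[i1 i2] /andP[i3 i4]]].
rewrite (height_on es) (height_on ft) => h.
move: es ft; rewrite !inE => /and4P[o1 o2 lt _] /and4P[p1 p2 lt' _].
have off v : on s v -> on t v -> x v = r.
  move=> ov pv; apply/eqP/negPn/negP => nr; move/eqP: st; apply.
  exact: (line_unique sD tD nr (eq1 v ov pv)).
rewrite /= !inE !negb_or andbT -!andbA.
apply/and5P; split; [| | | |apply/andP; split]; apply/eqP => E.
- by rewrite E ltxx in lt.
- by have := off e.1 o1; rewrite {1}E => /(_ p1) h1; rewrite h1 ltxx in i1.
- by have := off e.1 o1; rewrite {1}E => /(_ p2) h1; rewrite h1 ltxx in i1.
- by have := off e.2 o2; rewrite {1}E => /(_ p1) h1; rewrite h1 ltxx in i2.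
- by have := off e.2 o2; rewrite {1}E => /(_ p2) h1; rewrite h1 ltxx in i2.
- by rewrite E ltxx in lt'.
Qed.

(** Every point of the line except the rightmost one starts an edge. *)
Let edges_card t : (#|[set v | on t v]| <= #|edges t|.+1)%N.
Proof.
have [-> | [v0 v0on]] := set_0Vmem [set v | on t v]; first by rewrite cards0.
rewrite inE in v0on.
case: (Order.TotalTheory.arg_maxP x v0on) => z zon zmax.
rewrite (cardsD1 z) inE zon add1n ltnS.
have next v : v \in [set v | on t v] :\ z -> exists w, (v, w) \in edges t.
  rewrite !inE => /andP[vz von].
  have lt : x v < x z.
    rewrite lt_neqAle (zmax v von : x v <= x z) andbT.
    by apply: contraNneq vz => /x_inj ->.
  pose P w := on t w && (x v < x w).
  have Pz : P z by rewrite /P zon.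
  case: (Order.TotalTheory.arg_minP x Pz) => w /andP[won vw] wmin.
  exists w; rewrite inE /= von won vw /=; apply/forallP => u; apply/implyP => /andP[h1 h2].
  apply/negP => uon; have := wmin u; rewrite /P uon h1 => /(_ isT).
  by rewrite leNgt h2.
have : [set v | on t v] :\ z \subset [set e.1 | e in edges t].
  by apply/subsetP => v /next[w h]; apply/imsetP; exists (v, w).
by move/subset_leq_card/leq_trans; apply; apply: leq_imset_card.
Qed.

Let graph_card : (\sum_(t in D) #|edges t| <= #|graph|)%N.
Proof.
rewrite (eq_bigr (fun t => \sum_e if e \in edges t then 1 else 0)%N); last first.
  by move=> t _; rewrite -sum1_card big_mkcond.
rewrite exchange_big -sum1_card [leqRHS]big_mkcond; apply: leq_sum => e _ /=.
rewrite -big_mkcondr sum1dep_card.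
case: ifP => eG; last first.
  rewrite leqn0 cards_eq0; apply/eqP/setP => t; rewrite inE in_set0.

  apply/negbTE; apply/negP => /andP[tD et]; move/negbT/negP: eG; apply.
  by apply/graphP; exists t.
apply/card_le1_eqP => s t; rewrite inE => /andP[sD es]; rewrite inE => /andP[tD et].
exact: (edges_unique tD sD et es).
Qed.

Theorem szemeredi_trotter (k : R) : 2 <= k ->
    (forall t, t \in D -> k <= #|[set v | y v == a t * x v + b t]|%:R) ->
  #|D|%:R <= 2304 * (#|V|%:R ^+ 2 / k ^+ 3) + 12 * (#|V|%:R / k).
Proof.
move=> k2 rich; apply: (rich_line_arithmetic (E := #|graph|) (X := #|crossings x y graph|)).
- by lra.
- by rewrite -card_prod max_card.
- exact: graph_crossings.
- have : (\sum_(t in D) #|edges t|)%:R <= #|graph|%:R :> R by rewrite ler_nat graph_card.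
  (* A line carries at least [k - 1] edges, and [k - 1 >= k / 2] since [k >= 2]. *)
  suff : #|D|%:R * k <= 2 * (\sum_(t in D) #|edges t|)%:R by lra.
  rewrite natr_sum mulr_sumr mulr_natl -sumr_const; apply: ler_sum => t tD.
  have : (#|[set v | on t v]|%:R : R) <= #|edges t|.+1%:R by rewrite ler_nat edges_card.
  by have := rich t tD; rewrite /on -natr1; lra.
- move=> j; apply: crossing_lemma => //.
  + by move=> e /graphP[t _]; rewrite inE => /and4P[].
  + move=> e v /graphP[t _ et] i; rewrite (height_on et).
    by move: et; rewrite inE => /and4P[_ _ _ /forallP/(_ v)]; rewrite /between i.
Qed.

End SzemerediTrotter.

(** * Generic linear functionals and extension of subspaces *)

Lemma poly_nonroot (R : numDomainType) (p : {poly R}) :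
  p != 0 -> exists t, p.[t] != 0.
Proof.
move=> p0; pose rs : seq R := [seq i%:R | i <- iota 0 (size p)].
have urs : uniq rs.
  by rewrite map_inj_uniq ?iota_uniq // => i j /eqP; rewrite eqr_nat => /eqP.
have [/(max_poly_roots p0)/(_ urs)|/allPn[t _ nt]] := boolP (all (root p) rs).
  by rewrite size_map size_iota ltnn.
by exists t.
Qed.

(** The coordinates of [z - projv K z] are read as the coefficients of a polynomial, which is zero
    exactly for [z] in [K]. Evaluation at [t] is then linear in [z], and some [t] is no root of the
    product of the polynomials of [zs]. *)
Lemma generic_functional (R : realFieldType) (W : vectType R) (K : {vspace W})
    (zs : seq W) : {in zs, forall z, z \notin K} ->
  exists phi : {scalar W},
    {in K, forall z, phi z = 0} /\ {in zs, forall z, phi z != 0}.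
Proof.
move=> zsK; pose coords := passmx.rVof (vbasis {:W}).
pose pol z := rVpoly (coords (z - projv K z)).
have pol0 z : (pol z == 0) = (z \in K).
  have -> : (pol z == 0) = (coords (z - projv K z) == 0).
    apply/eqP/eqP => [|e]; last by rewrite /pol e linear0.
    by rewrite /pol => e; rewrite -[LHS]rVpolyK e linear0.
  rewrite (passmx.rVof_eq0 (vbasisP _)) subr_eq0.
  by apply/eqP/idP => [->|/projv_id ->//]; rewrite memv_proj.
have [t] : exists t, (\prod_(z <- zs) pol z).[t] != 0.
  apply: poly_nonroot; rewrite prodf_seq_neq0; apply/allP => z /zsK.
  by rewrite -pol0.
rewrite horner_prod prodf_seq_neq0 => /allP nz.
pose f z := (pol z).[t].
have f_lin : scalar f.
  move=> a z w; rewrite /f; have -> : pol (a *: z + w) = a *: pol z + pol w.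
    rewrite /pol [projv K _]linearP opprD addrACA -scalerBr.
    by rewrite /coords passmx.rVof_linear rvPoly_is_linear.
  by rewrite hornerD hornerZ.
pose phi : {scalar W} := HB.pack f (GRing.isLinear.Build _ _ _ _ f f_lin).
exists phi; split=> z; rewrite [phi z]/(f z); last by move/nz.
by rewrite -pol0 /f => /eqP ->; rewrite horner0.
Qed.

Lemma dim_add_line (F : fieldType) (W : vectType F) (K : {vspace W}) w :
  w \notin K -> \dim (K + <[w]>) = (\dim K).+1.
Proof.
move=> wK; rewrite dimv_disjoint_sum; last first.
  apply/eqP; rewrite -subv0; apply/subvP => z; rewrite memv_cap => /andP[zK /vlineP[a za]].
  have [a0|a0] := eqVneq a 0; first by rewrite za a0 scale0r mem0v.
  by case/negP: wK; rewrite -(scalerK a0 w) -za memvZ.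
rewrite dim_vline (_ : w != 0) ?addn1 //.
by apply: contraNneq wK => ->; rewrite mem0v.
Qed.

Lemma vspace_extend (F : fieldType) (W : vectType F) (V M : {vspace W}) n :
    (V <= M)%VS -> (\dim V <= n <= \dim M)%N ->
  exists H : {vspace W}, [/\ (V <= H)%VS, (H <= M)%VS & \dim H = n].
Proof.
move=> VM /andP[Vn nM]; elim: n Vn nM => [|n IHn].
  by rewrite leqn0 => /eqP dV _; exists V.
rewrite leq_eqVlt => /orP[/eqP <- _|]; first by exists V.
rewrite ltnS => Vn nM; have [H [VH HM dH]] := IHn Vn (ltnW nM).
have /subvPn[w wM wH] : ~~ (M <= H)%VS.
  by apply: contraL nM => /dimvS; rewrite dH -leqNgt.
exists (H + <[w]>)%VS; split.
- exact: subv_trans VH (addvSl _ _).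
- by rewrite subv_add HM -memvE.
- by rewrite dim_add_line // dH.
Qed.

(** * Szemeredi-Trotter after projection from a subspace *)

Section RelativeSzemerediTrotter.
Variables (R : realFieldType) (W : vectType R) (I : finType) (u : I -> W).
Implicit Types (K : {vspace W}) (J Q : {set I}).

(* The points of J avoid the centre K and have distinct images under the
   projection from K. *)
Definition simple_mod K J : bool :=
  [forall s in J, u s \notin K] &&
  [forall s in J, forall t in J, (s != t) ==> (u t \notin (K + <[u s]>)%VS)].

Lemma simple_modP K J :
  reflect ({in J, forall s, u s \notin K} /\
           {in J &, forall s t, s != t -> u t \notin (K + <[u s]>)%VS})
          (simple_mod K J).
Proof.
apply: (iffP andP) => -[h1 h2]; split.
- exact/forall_inP.
- by move=> s t sJ tJ; move/forall_inP/(_ s sJ)/forall_inP/(_ t tJ)/implyP: h2.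
- exact/forall_inP.
- by apply/forall_inP => s sJ; apply/forall_inP => t tJ; apply/implyP; apply: h2.
Qed.

Lemma span_pair K M s t : (K <= M)%VS -> \dim M = (\dim K + 2)%N ->
    u s \in M -> u t \in M -> u s \notin K -> u t \notin (K + <[u s]>)%VS ->
  (K + <[u s]> + <[u t]>)%VS = M.
Proof.
move=> KM dM sM tM sK tK; apply/eqP; rewrite eqEdim !subv_add KM -!memvE sM tM /=.
by rewrite dim_add_line // dim_add_line // dM addn2.
Qed.

(* For generic functionals h, f, g vanishing on K, the map (f/h, g/h) embeds the
   projection from K into an affine plane, with injective first coordinate on
   projected points, and sends the spaces M t to distinct lines. *)
Theorem relative_szemeredi_trotter (T : finType) (D : {set T})
    (M : T -> {vspace W}) K Q (k : R) : 2 <= k ->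
    {in D &, injective M} ->
    (forall t, t \in D -> (K <= M t)%VS /\ \dim (M t) = (\dim K + 2)%N) ->
    (forall t, t \in D -> exists J : {set I},
       [/\ J \subset Q, simple_mod K J, {in J, forall s, u s \in M t}
         & k <= #|J|%:R]) ->
  #|D|%:R <= 2304 * (#|Q|%:R ^+ 2 / k ^+ 3) + 12 * (#|Q|%:R / k).
Proof.
move=> k2 Minj KM rich.
pose Q0 := [set s in Q | u s \notin K].
have [h [hK hQ]] : exists phi : {scalar W}, {in K, forall z, phi z = 0} /\
    {in [seq u s | s in Q0], forall z, phi z != 0}.
  by apply: generic_functional => z /imageP[s + ->]; rewrite inE => /andP[].
have {}hQ s : s \in Q0 -> h (u s) != 0.
  by move=> sQ; apply: hQ; apply: image_f.
(* Scaling to [h = 1] puts the points into an affine chart. *)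
pose v s := (h (u s))^-1 *: u s.
have hv s : s \in Q0 -> h (v s) = 1 by move=> /hQ sQ; rewrite /v linearZ /= mulVf.
have vM s (L : {vspace W}) : s \in Q0 -> (v s \in L) = (u s \in L).
  by move=> /hQ sQ; rewrite /v rpredZeq invr_eq0 (negbTE sQ).
have uv s : s \in Q0 -> u s = h (u s) *: v s.
  by move=> sQ; rewrite /v scalerA mulfV ?scale1r // hQ.
clearbody v.
have [f [fK fQ]] : exists phi : {scalar W}, {in K, forall z, phi z = 0} /\
    {in [seq z <- [seq v p.1 - v p.2 | p in setX Q0 Q0] | z \notin K],
     forall z, phi z != 0}.
  by apply: generic_functional => z; rewrite mem_filter => /andP[].
have {}fQ s t : s \in Q0 -> t \in Q0 -> f (v s) = f (v t) -> v s - v t \in K.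
  move=> sQ tQ st; apply/negPn/negP => nK; have /fQ : v s - v t \in
    [seq z <- [seq v p.1 - v p.2 | p in setX Q0 Q0] | z \notin K].
    by rewrite mem_filter nK; apply/imageP; exists (s, t); rewrite // inE sQ tQ.
  by rewrite linearB /= st subrr eqxx.
pose x s := f (v s).
(* [f] vanishes on this vector, and [g] does so exactly when the images of [s], [t], [r] under
   [(f, g)] are collinear. For a generic [g], collinear images therefore force [zz s t r] into [K],
   which is collinearity after projection from [K] when [x s != x t]. *)
pose zz s t r := (x t - x s) *: (v r - v s) - (x r - x s) *: (v t - v s).
have [g [gK gQ]] : exists phi : {scalar W}, {in K, forall z, phi z = 0} /\
    {in [seq z <- [seq zz p.1.1 p.1.2 p.2 | p in [set: I * I * I]] | z \notin K],
     forall z, phi z != 0}.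
  by apply: generic_functional => z; rewrite mem_filter => /andP[].
have {}gQ s t r : g (zz s t r) = 0 -> zz s t r \in K.
  move=> st; apply/negPn/negP => nK; have /gQ : zz s t r \in
    [seq z <- [seq zz p.1.1 p.1.2 p.2 | p in [set: I * I * I]] | z \notin K].
    by rewrite mem_filter nK; apply/imageP; exists (s, t, r); rewrite // inE.
  by rewrite st eqxx.
pose y s := g (v s).
have yx s t : s \in Q0 -> t \in Q0 -> x s = x t -> y s = y t.
  move=> sQ tQ /(fQ _ _ sQ tQ)/gK; rewrite linearB /= => /eqP.
  by rewrite subr_eq0 => /eqP.
have xJ J s t : J \subset Q -> simple_mod K J -> s \in J -> t \in J -> x s = x t -> s = t.
  move=> /subsetP JQ /simple_modP[J1 J2] sJ tJ xst; apply/eqP/negPn/negP => st.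
  have sQ : s \in Q0 by rewrite inE JQ // J1.
  have tQ : t \in Q0 by rewrite inE JQ // J1.
  have := J2 t s tJ sJ; rewrite eq_sym => /(_ st)/negP; apply.
  rewrite -vM // -(subrK (v t) (v s)) memv_add //; first exact: fQ.
  by rewrite vM // memv_line.
have line t : exists ab : R * R, t \in D ->
    (exists s1 s2, [/\ s1 \in Q0, s2 \in Q0, x s1 != x s2,
       (K + <[u s1]> + <[u s2]>)%VS = M t & u s1 \in M t /\ u s2 \in M t]) /\
    {in Q0, forall r, u r \in M t -> y r = ab.1 * x r + ab.2}.
  have [tD|] := boolP (t \in D); last by exists (0, 0).
  have [J [JQ Js JM kJ]] := rich t tD.
  have /card_gt1P[s1 [s2 [s1J s2J s12]]] : (1 < #|J|)%N.
    by rewrite -(ltr_nat R); lra.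
  have /simple_modP[J1 J2] := Js.
  have s1Q : s1 \in Q0 by rewrite inE (subsetP JQ) // J1.
  have s2Q : s2 \in Q0 by rewrite inE (subsetP JQ) // J1.
  have x12 : x s1 != x s2 by apply: contraNneq s12 => /(xJ J _ _ JQ Js s1J s2J) ->.
  have [Kt dMt] := KM t tD.
  have sp : (K + <[u s1]> + <[u s2]>)%VS = M t.
    by apply: span_pair; rewrite ?JM ?J1 ?J2.
  pose a := (y s2 - y s1) / (x s2 - x s1).
  exists (a, y s1 - a * x s1) => _; split.
    by exists s1, s2; rewrite !JM.
  move=> r rQ rM /=.
  have : v r \in (K + <[u s1]> + <[u s2]>)%VS by rewrite vM // sp.
  move=> /memv_addP[_ /memv_addP[z zK [_ /vlineP[c1 ->] ->]] [_ /vlineP[c2 ->] vE]].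
  rewrite (uv _ s1Q) (uv _ s2Q) !scalerA in vE.
  move: (c1 * _) (c2 * _) vE => d1 d2 vE.
  have e1 : d1 + d2 = 1.
    rewrite -(hv r rQ) vE !linearD !linearZ /= (hK _ zK) (hv _ s1Q) (hv _ s2Q); ring.
  have e2 : x r = d1 * x s1 + d2 * x s2.
    by rewrite /x vE !linearD !linearZ /= (fK _ zK) add0r.
  have e3 : y r = d1 * y s1 + d2 * y s2.
    by rewrite /y vE !linearD !linearZ /= (gK _ zK) add0r.
  have e4 : a * (x s2 - x s1) = y s2 - y s1.
    by rewrite /a mulfVK // subr_eq0 eq_sym.
  rewrite e3 e2 (_ : d1 = 1 - d2); last by lra.
  rewrite (_ : a * _ + _ = y s1 + d2 * (a * (x s2 - x s1))); last by ring.
  by rewrite e4; ring.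
have [ab abP] := choice line.
(* The points fed to the planar theorem are the distinct abscissae. Since [x] determines [y], the
   ordinate [y'] is well defined, and its default 0 does not occur on [S]. *)
pose S := undup [seq x s | s in Q0].
pose y' (p : R) := if [pick s in Q0 | x s == p] is Some s then y s else 0.
have y'x s : s \in Q0 -> y' (x s) = y s.
  move=> sQ; rewrite /y'; case: pickP => [r /andP[rQ /eqP]|/(_ s)]; first exact: yx.
  by rewrite sQ eqxx.
have SQ : (#|{: seq_sub S}| <= #|Q|)%N.
  rewrite card_seq_sub ?undup_uniq //; apply: leq_trans (size_undup _) _.
  rewrite size_image; apply: subset_leq_card; apply/subsetP => s.
  by rewrite inE => /andP[].
have k0 : 0 < k by lra.
have ST := @szemeredi_trotter R (seq_sub S : finType) T (@ssval _ S) (fun p => y' (ssval p))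
  (fun t => (ab t).1) (fun t => (ab t).2) D val_inj.
apply: le_trans (ST _ k k2 _) _.
(* If [M t] and [M t'] have the same image line, genericity of [g] puts the points of [M t'] into
   [M t]; two of them span [M t'] over [K], and the dimensions agree. *)
- move=> t t' tD t'D a1 a2.
  have [[s1 [s2 [s1Q s2Q x12 sp [sM1 sM2]]]] onl] := abP t tD.
  have [[r1 [r2 [r1Q r2Q _ spr [rM1 rM2]]]] onl'] := abP t' t'D.
  have inM r : r \in Q0 -> u r \in M t' -> u r \in M t.
    move=> rQ rM; rewrite -vM //.
    have : zz s1 s2 r \in K.
      apply: gQ; rewrite /zz linearB !linearZ /= !linearB /= -/(y r) -/(y s1) -/(y s2).
      rewrite (onl s1 s1Q sM1) (onl s2 s2Q sM2) (onl' r rQ rM) a1 a2; ring.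
    have [KMt _] := KM t tD.
    move/(subvP KMt); rewrite /zz => zM.
    have {}zM : (x s2 - x s1) *: (v r - v s1) \in M t.
      by rewrite -[X in X \in _](subrK ((x r - x s1) *: (v s2 - v s1))) memvD // rpredZeq rpredB ?orbT // vM.
    move: zM; rewrite rpredZeq subr_eq0 eq_sym (negbTE x12) /= => zM.
    by rewrite -(subrK (v s1) (v r)) memvD // vM.
  apply: Minj => //; apply/esym/eqP; rewrite eqEdim.
  have [KMt dt] := KM t tD; have [_ dt'] := KM t' t'D.
  by rewrite -{1}spr !subv_add KMt -!memvE !inM // dt dt' leqnn.
- move=> t tD; have [J [JQ Js JM kJ]] := rich t tD.
  apply: le_trans kJ _; rewrite ler_nat.
  have JS s : s \in J -> x s \in S.
    move=> sJ; rewrite mem_undup; apply: image_f; rewrite inE (subsetP JQ) //.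
    by have /simple_modP[-> //] := Js.
  have [[s1 _] onl] := abP t tD.
  pose F s : option (seq_sub S) := insub (x s).
  have FE s : s \in J -> exists2 p, F s = Some p & ssval p = x s.
    by move=> /JS sS; rewrite /F insubT; eexists.
  have Finj : {in J &, injective F}.
    move=> s r sJ rJ; have [p -> ps] := FE s sJ; have [q -> qs] := FE r rJ => -[pq].
    by apply: (xJ J) => //; rewrite -ps -qs pq.
  rewrite -(card_in_imset Finj) -[leqRHS](card_imset _ (@Some_inj _)).
  apply: subset_leq_card; apply/subsetP => _ /imsetP[s sJ ->].
  have [p -> ps] := FE s sJ; apply: imset_f; rewrite inE ps.
  have sQ : s \in Q0 by rewrite inE (subsetP JQ) //; have /simple_modP[-> //] := Js.
  by rewrite y'x // onl // JM.
have SQ' : (#|{: seq_sub S}|%:R : R) <= #|Q|%:R by rewrite ler_nat.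
apply: lerD; apply: ler_wpM2l => //; apply: ler_wpM2r => //.
- by rewrite invr_ge0 exprn_ge0 // ltW.
- by rewrite lerXn2r ?nnegrE.
- by rewrite invr_ge0 ltW.
Qed.

End RelativeSzemerediTrotter.

(** * Beck's theorem *)

(** Telescoping with [(k + 1) ^ 2 - k ^ 2 <= 2 (k + 1)]. The range up to [L] does not depend on [a],
    so the sum can later be exchanged with a sum over lines. *)
Lemma sqr_le_sum (c a L : nat) : (c <= a <= L)%N ->
  (a ^ 2 <= c ^ 2 + \sum_(c <= k < L) if k < a then 2 * k.+1 else 0)%N.
Proof.
move=> /andP[ca aL]; rewrite (big_cat_nat ca aL) /= addnA.
apply: leq_trans (leq_addr _ _); move: {aL}ca; elim: a => [|a IHa].
  by rewrite leqn0 => /eqP->.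
rewrite leq_eqVlt => /orP[/eqP->|]; first by rewrite leq_addr.
rewrite ltnS => ca; rewrite big_nat_recr //= ltnS leqnn addnA.
apply: (@leq_trans (a ^ 2 + 2 * a.+1)%N); first by nia.
rewrite leq_add2r (leq_trans (IHa ca)) // leq_add2l.
rewrite big_nat_cond [leqRHS]big_nat_cond; apply: leq_sum => k.
by rewrite andbT => /andP[_ ka]; rewrite ka (ltnW ka : k < a.+1)%N.
Qed.

(** Telescoping with [1 / (k + 1) ^ 2 <= 1 / k - 1 / (k + 1)]. *)
Lemma sum_inv_sqr (R : realFieldType) (c L : nat) : (0 < c <= L)%N ->
  \sum_(c <= k < L) (k.+1%:R ^- 2 : R) <= c%:R^-1.
Proof.
move=> /andP[c0 cL].
suff : \sum_(c <= k < L) (k.+1%:R ^- 2 : R) <= c%:R^-1 - L%:R^-1.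
  by move/le_trans; apply; rewrite gerBl invr_ge0.
apply: (@le_trans _ _ (\sum_(c <= k < L) ((k%:R^-1 : R) - k.+1%:R^-1))).
  rewrite big_nat_cond [leRHS]big_nat_cond; apply: ler_sum => k.
  rewrite andbT => /andP[ck _]; have k0 : 0 < k%:R :> R by rewrite ltr0n (leq_trans c0).
  have k1 : 0 < k.+1%:R :> R by rewrite ltr0n.
  have -> : k%:R^-1 - k.+1%:R^-1 = (k%:R * k.+1%:R)^-1 :> R.
    by rewrite -natr1 in k1 *; field; rewrite !lt0r_neq0.
  rewrite lef_pV2 ?posrE ?mulr_gt0 ?exprn_gt0 // expr2 ler_pM2r // ler_nat leqnSn //.
rewrite (@telescope_sumr_eq _ c L (fun k => - (k%:R^-1 : R))) //; last first.
  by move=> k _; rewrite opprK addrC.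
by rewrite opprK addrC.
Qed.

Lemma card_bigcup_le (T J : finType) (A : {set J}) (F : J -> {set T}) :
  (#|\bigcup_(j in A) F j| <= \sum_(j in A) #|F j|)%N.
Proof.
elim/big_ind2: _ => [|m X n Y Xm Yn|//]; first by rewrite cards0.
by apply: leq_trans (leq_card_setU X Y).1 _; apply: leq_add.
Qed.

Section Beck.
Variables (R : realFieldType) (W : vectType R) (I : finType) (u : I -> W).
Implicit Types (K : {vspace W}) (J Q : {set I}).

Lemma add_line_exchange K w z :
  w \notin K -> w \in (K + <[z]>)%VS -> z \in (K + <[w]>)%VS.
Proof.
move=> wK /memv_addP[k kK [_ /vlineP[a ->] wE]].
have a0 : a != 0 by apply: contraNneq wK => a0; rewrite wE a0 scale0r addr0.
have -> : z = a^-1 *: (w - k) by rewrite wE [k + _]addrC addrK scalerA mulVf ?scale1r.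
rewrite rpredZeq addrC memv_add ?orbT //; first by rewrite memvN.
exact: memv_line.
Qed.

Lemma simple_mod0 K : simple_mod u K set0.
Proof. by apply/simple_modP; split=> [s|s t]; rewrite inE. Qed.

(** For [J] maximal among the simple subsets of [T], every point of [T] has the same projection as
    some point of [J], and at most [c] points share a projection. *)
Lemma simple_mod_transversal K (T : {set I}) (c : nat) :
    {in T, forall t, u t \notin K} ->
    {in T, forall t, #|[set r in T | u r \in (K + <[u t]>)%VS]| <= c}%N ->
  exists J : {set I}, [/\ J \subset T, simple_mod u K J & (#|T| <= c * #|J|)%N].
Proof.
move=> TK Tc.
pose P (J : {set I}) := (J \subset T) && simple_mod u K J.
have [J /maxsetP[/andP[JT Js] Jmax]] : {J | maxset P J}.
  by apply: (@ex_maxset _ P); exists set0; rewrite /P sub0set simple_mod0.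
exists J; split=> //.
have sub : T \subset \bigcup_(j in J) [set r in T | u r \in (K + <[u j]>)%VS].
  apply/subsetP => r rT; apply/bigcupP.
  have [/exists_inP[j jJ rj]|] := boolP [exists j in J, u r \in (K + <[u j]>)%VS].
    by exists j; rewrite // inE rT.
  move/exists_inPn => nJ.
  have rJ : r \notin J.
    by apply/negP => /nJ; rewrite -[X in X \notin _]add0r memv_add ?mem0v ?memv_line.
  have /Jmax : P (r |: J).
    rewrite /P subUset sub1set rT JT /=; have /simple_modP[J1 J2] := Js.
    apply/simple_modP; split=> [s|s t].
      by rewrite !inE => /orP[/eqP->|/J1 //]; apply: TK.
    rewrite !inE => /orP[/eqP->|sJ] /orP[/eqP->|tJ]; rewrite ?eqxx // => st.
    - by apply: contra (nJ t tJ); apply: add_line_exchange; apply: J1.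
    - exact: nJ.
    - exact: J2.
  by move=> /(_ (subsetUr _ _)) E; rewrite -E setU11 in rJ.
apply: leq_trans (subset_leq_card sub) _.
rewrite mulnC -sum_nat_const; apply: leq_trans (card_bigcup_le _ _) _.
by apply: leq_sum => j jJ; apply: Tc; apply: (subsetP JT).
Qed.

(** A line of the projection from [K], encoded as the set of points of [Q] on it. *)
Definition line_mod K Q (s t : I) : {set I} :=
  [set r in Q | u r \in (K + <[u s]> + <[u t]>)%VS].

Lemma simple_modS K J Q : J \subset Q -> simple_mod u K Q -> simple_mod u K J.
Proof.
move=> /subsetP JQ /simple_modP[Q1 Q2]; apply/simple_modP.
by split=> [s /JQ/Q1 //|s t /JQ sQ /JQ tQ]; apply: Q2.
Qed.

Lemma mem_line_mod K Q s t : s \in Q -> t \in Q ->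
  (s \in line_mod K Q s t) && (t \in line_mod K Q s t).
Proof.
move=> sQ tQ; rewrite !inE sQ tQ !memvE addvSr andbT.
by rewrite andbT; apply: subv_trans (addvSr K _) (addvSl _ _).
Qed.

(** A line given as a point set [A] determines its subspace as the span [M A], so
    [relative_szemeredi_trotter] applies with [A] itself as the witness of richness. *)
Lemma rich_lines_bound K Q (F : {set {set I}}) (k : nat) :
    simple_mod u K Q -> (1 < k)%N ->
    (forall A, A \in F -> (k <= #|A|)%N /\ exists s t,
       [/\ s \in Q, t \in Q, s != t & A = line_mod K Q s t]) ->
  #|F|%:R <= 2304 * (#|Q|%:R ^+ 2 / k%:R ^+ 3) + 12 * (#|Q|%:R / k%:R) :> R.
Proof.
move=> Qs k1 Fl; have /simple_modP[Q1 Q2] := Qs.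
pose M (A : {set I}) := (K + \sum_(s in A) <[u s]>)%VS.
have ME s t : s \in Q -> t \in Q -> M (line_mod K Q s t) = (K + <[u s]> + <[u t]>)%VS.
  move=> sQ tQ; apply/eqP; rewrite eqEsubv; apply/andP; split.
    rewrite subv_add -{1}addvA addvSl /=; apply/subv_sumP => r.
    by rewrite inE => /andP[_]; rewrite memvE.
  have /andP[sl tl] := mem_line_mod K sQ tQ.
  rewrite !subv_add addvSl /=; apply/andP; split.
    by apply: subv_trans (addvSr _ _); apply: (sumv_sup s).
  by apply: subv_trans (addvSr _ _); apply: (sumv_sup t).
apply: (relative_szemeredi_trotter (u := u) (M := M) (K := K) (Q := Q)).
- by rewrite ler_nat.
- move=> A B /Fl[_ [s [t [sQ tQ _ ->]]]] /Fl[_ [s' [t' [sQ' tQ' _ ->]]]].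
  by rewrite !ME // /line_mod => ->.
- move=> A /Fl[_ [s [t [sQ tQ st ->]]]]; rewrite ME // -addvA addvSl addvA.
  by rewrite dim_add_line ?Q2 // dim_add_line ?Q1 // addn2.
- move=> A /Fl[kA [s [t [sQ tQ st AE]]]]; exists A.
  have AQ : A \subset Q by rewrite AE; apply/subsetP => r; rewrite inE => /andP[].
  rewrite ler_nat kA AQ (simple_modS AQ Qs); split=> // r.
  by rewrite AE ME // inE => /andP[].
Qed.

Lemma rich_pairs_bound K Q (c L : nat) : simple_mod u K Q -> (0 < c <= L)%N ->
    {in Q &, forall s t, s != t -> #|line_mod K Q s t| <= L}%N ->
  #|[set p in setX Q Q | (p.1 != p.2) && (c < #|line_mod K Q p.1 p.2|)%N]|%:R
    <= 3 * 2304 * (#|Q|%:R ^+ 2 / c%:R) + 3 * 12 * (#|Q|%:R * L%:R) :> R.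
Proof.
move=> Qs cL QL; have /andP[c0 cL'] := cL.
(* Summation by parts: a line with a > c points contributes
   a^2 <= c^2 + \sum_(c <= k < a) 2 (k + 1) pairs, and the number of lines with
   more than k points is controlled for each k. *)
set B := [set p in _ | _].
pose ln p := line_mod K Q p.1 p.2.
pose G := [set ln p | p in B].
have GP A : A \in G -> (c < #|A| <= L)%N /\ exists s t,
    [/\ s \in Q, t \in Q, s != t & A = line_mod K Q s t].
  move=> /imsetP[[s t]]; rewrite !inE /= => /andP[/andP[sQ tQ] /andP[st cs]] ->.
  by split; [rewrite cs QL | exists s, t].
have BG : (#|B| <= \sum_(A in G) #|A| ^ 2)%N.
  rewrite -sum1_card (partition_big_imset ln) /= -/G; apply: leq_sum => A AG.
  rewrite sum1dep_card -mulnn -cardsX; apply: subset_leq_card.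
  apply/subsetP => -[s t]; rewrite inE => /andP[].
  rewrite !inE /= => /andP[/andP[sQ tQ] _] /eqP <-.
  exact: mem_line_mod.
have {}BG : (#|B| <= #|G| * c ^ 2 +
    \sum_(c <= k < L) #|[set A in G | k < #|A|]| * (2 * k.+1))%N.
  apply: leq_trans BG _; rewrite -sum_nat_const.
  rewrite (eq_bigr (fun k => \sum_(A in G) if k < #|A| then 2 * k.+1 else 0)%N); last first.
    move=> k _; rewrite -big_mkcondr -sum_nat_const.
    by apply: eq_bigl => A; rewrite inE.
  rewrite exchange_big -big_split /=; apply: leq_sum => A /GP[/andP[cA AL] _].
  by apply: sqr_le_sum; rewrite (ltnW cA).
set N := #|Q|%:R : R.
have N0 : 0 <= N by rewrite /N.
have cR : 0 < c%:R :> R by rewrite ltr0n.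
have fk k : (c <= k)%N -> #|[set A in G | (k < #|A|)%N]|%:R <=
    2304 * (N ^+ 2 / k.+1%:R ^+ 3) + 12 * (N / k.+1%:R) :> R.
  move=> ck; apply: (rich_lines_bound Qs); first by rewrite ltnS (leq_trans c0).
  by move=> A; rewrite inE => /andP[/GP[_ ?] ?].
have G1 : #|G|%:R * c%:R ^+ 2 <= 2304 * (N ^+ 2 / c%:R) + 12 * (N * c%:R) :> R.
  have GE : [set A in G | (c < #|A|)%N] = G.
    by apply/setP => A; rewrite inE; case AG: (A \in G) => //=; have [/andP[->]] := GP A AG.
  have := fk c (leqnn c); rewrite GE => /(ler_wpM2r (exprn_ge0 2 (ltW cR))) /le_trans; apply.
  rewrite mulrDl; have cc : c%:R <= c.+1%:R :> R by rewrite ler_nat.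
  have c1 : 0 < c.+1%:R :> R by rewrite ltr0n.
  apply: lerD; rewrite -!mulrA; do 2!(apply: ler_wpM2l => //).
    apply: ler_wpM2l => //.
    rewrite [leLHS]mulrC ler_pdivrMr ?exprn_gt0 // mulrC ler_pdivlMr // -exprSr.
    by rewrite lerXn2r // nnegrE ltW.
  rewrite mulrC ler_pdivrMr // expr2 ler_wpM2l // ltW //.
(* By [fk] the term at [k] is at most a multiple of [1 / (k + 1) ^ 2] plus a constant; [sum_inv_sqr]
   bounds the first part, and the constant occurs at most [L] times. *)
have G2 : \sum_(c <= k < L) #|[set A in G | (k < #|A|)%N]|%:R * (2 * k.+1%:R) <=
    2 * 2304 * (N ^+ 2 / c%:R) + 2 * 12 * (N * L%:R) :> R.
  apply: (@le_trans _ _ (\sum_(c <= k < L)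
    (2 * 2304 * N ^+ 2 * k.+1%:R ^- 2 + 2 * 12 * N))).
    rewrite big_nat_cond [leRHS]big_nat_cond; apply: ler_sum => k; rewrite andbT => /andP[ck _].
    have k0 : 0 < k.+1%:R :> R by rewrite ltr0n.
    have k2 : 0 <= 2 * k.+1%:R :> R by rewrite mulr_ge0 // ltW.
    apply: le_trans (ler_wpM2r k2 (fk k ck)) _.
    rewrite le_eqVlt; apply/orP; left; apply/eqP.
    by move: (k.+1%:R) k0 => r r0; field; rewrite lt0r_neq0.
  rewrite big_split /= -mulr_sumr; apply: lerD.
    rewrite [leRHS]mulrA; apply: ler_wpM2l (sum_inv_sqr R cL).
    by rewrite !mulr_ge0 ?exprn_ge0.
  rewrite sumr_const_nat -[leLHS]mulr_natr -!mulrA; do 3!(apply: ler_wpM2l => //).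
  by rewrite ler_nat leq_subr.
have cLR : 12 * (N * c%:R) <= 12 * (N * L%:R).
  by apply: ler_wpM2l => //; apply: ler_wpM2l => //; rewrite ler_nat.
have : #|B|%:R <= #|G|%:R * c%:R ^+ 2 +
    \sum_(c <= k < L) #|[set A in G | (k < #|A|)%N]|%:R * (2 * k.+1%:R) :> R.
  apply: (@le_trans _ _ (#|G| * c ^ 2 +
    \sum_(c <= k < L) #|[set A in G | k < #|A|]| * (2 * k.+1))%N%:R).
    by rewrite ler_nat.
  rewrite natrD natrM natrX natr_sum lerD2l; apply: ler_sum => k _.
  by rewrite !natrM.
lra.
Qed.

(* The form of Beck's theorem needed here, for the projection from K. *)
Lemma many_centers K Q (c : nat) : simple_mod u K Q -> (4 <= #|Q|)%N ->
    24 * 2304 <= c%:R :> R ->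
    {in Q &, forall s t, s != t -> 288 * #|line_mod K Q s t| <= #|Q|}%N ->
  exists S : {set I}, [/\ S \subset Q, (#|Q| <= 4 * #|S|)%N
    & forall s, s \in S -> exists J : {set I}, [/\ J \subset Q,
        simple_mod u (K + <[u s]>) J & (#|Q| <= 4 * c * #|J|)%N]].
Proof.
move=> Qs Q4 cbig Qlines; have /simple_modP[Q1 Q2] := Qs.
pose L := (#|Q| %/ 288)%N.
have Lsmall : (288 * L <= #|Q|)%N by rewrite mulnC leq_trunc_div.
have QL : {in Q &, forall s t, s != t -> #|line_mod K Q s t| <= L}%N.
  by move=> s t sQ tQ st; rewrite leq_divRL // mulnC Qlines.
clearbody L.
have c0 : (0 < c)%N by rewrite -(ltr0n R); lra.
set N := #|Q|.
pose B := [set p in setX Q Q | (p.1 != p.2) && (c < #|line_mod K Q p.1 p.2|)%N].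
(* The constants [24 * 2304] and 288 make each of the two terms of [rich_pairs_bound] at most
   [N ^ 2 / 8]. *)
have Bsmall : (4 * #|B| <= N ^ 2)%N.
  have [cL|Lc] := leqP c L; last first.
    have -> : B = set0.
      apply/setP => p; rewrite !inE; apply/negbTE; apply/negP.
      move=> /andP[/andP[pQ qQ] /andP[pq]]; have := QL _ _ pQ qQ pq.
      by move: Lc; move: (#|_|) => ?; lia.
    by rewrite cards0 muln0.
  rewrite -(ler_nat R) natrM natrX.
  have := @rich_pairs_bound K Q c L Qs; rewrite c0 cL => /(_ isT QL); rewrite -/B -/N.
  have N0 : 0 <= N%:R :> R by [].
  have cR : 0 < c%:R :> R by rewrite ltr0n.
  have h1 : N%:R ^+ 2 / c%:R * (24 * 2304) <= N%:R ^+ 2 :> R.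
    by rewrite -mulrA ger_pMr ?exprn_gt0 ?ltr0n ?(leq_trans _ Q4) // ler_pdivrMl // mulr1.
  have h2 : N%:R * L%:R * 288 <= N%:R ^+ 2 :> R.
    rewrite -mulrA expr2; apply: ler_wpM2l => //.
    by rewrite mulrC -natrM ler_nat.
  lra.
pose T s := [set t in Q | (s != t) && (#|line_mod K Q s t| <= c)%N].
pose S := [set s in Q | (N <= 4 * #|T s|)%N].
exists S; split.
- by apply/subsetP => s; rewrite inE => /andP[].
- have TN s : (#|T s| <= N)%N.
    by apply: subset_leq_card; apply/subsetP => t; rewrite inE => /andP[].
  (* As [N >= 4], at least [N ^ 2 / 2] ordered pairs of distinct points are outside [B], while
     points with fewer than [N / 4] partners account for at most [N ^ 2 / 4] of them. Hence [S] is
     large. *)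
  have sumT : (N * (N - 1) <= \sum_(s in Q) #|T s| + #|B|)%N.
    have TB s : s \in Q -> (N - 1 <= #|T s| + #|[set t in Q | (s, t) \in B]|)%N.
      move=> sQ; rewrite /N (cardsD1 s) sQ add1n subn1 /=.
      apply: leq_trans (leq_card_setU _ _).1; apply: subset_leq_card; apply/subsetP => t.
      rewrite !inE /= => /andP[ts tQ]; rewrite sQ tQ eq_sym ts /=.
      by case: leqP.
    rewrite -sum_nat_const; apply: leq_trans (leq_sum _ TB) _; rewrite big_split /= leq_add2l.
    rewrite (eq_bigr (fun s => \sum_(t in Q | (s, t) \in B) 1)%N); last first.
      by move=> s _; rewrite -sum1_card; apply: eq_bigl => t; rewrite inE.
    rewrite pair_big_dep /= sum1dep_card; apply: subset_leq_card.
    by apply/subsetP => -[s t]; rewrite inE => /and3P[].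
  have SQ s : (s \in Q) && (s \in S) = (s \in S) by rewrite inE andbA andbb.
  have : (4 * \sum_(s in Q) #|T s| <= N * N + #|S| * (3 * N))%N.
    rewrite big_distrr /= -!sum_nat_const -(eq_bigl _ _ SQ) big_mkcondr -big_split /=.
    apply: leq_sum => s sQ; case: ifP; first by have := TN s; lia.
    by rewrite inE sQ /= => /negbT; lia.
  move: sumT Bsmall Q4; rewrite -/N; move: (\sum_(s in Q) _)%N #|B| #|S| => X Y Z.
  nia.
move=> s; rewrite inE => /andP[sQ sT].
(* The lines from [s] to points of [T s] have at most [c] points each; [J] takes one representative
   per direction. *)
have [J [JT Js cJ]] : exists J : {set I},
    [/\ J \subset T s, simple_mod u (K + <[u s]>) J & (#|T s| <= c * #|J|)%N].
  apply: simple_mod_transversal => t; rewrite inE => /and3P[tQ st tc]; first exact: Q2.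
  apply: leq_trans tc; apply: subset_leq_card; apply/subsetP => r.
  by rewrite !inE => /andP[/andP[-> _] ->].
exists J; split=> //.
  by apply: subset_trans JT _; apply/subsetP => t; rewrite inE => /andP[].
by apply: leq_trans sT _; rewrite -mulnA leq_mul2l.
Qed.

End Beck.

(** * Wide pairs *)

Lemma card_fibers_ge (R : numDomainType) (T T' : finType) (P : {set T * T'})
    (X : {set T}) (n : R) :
    (forall s, s \in X -> n <= #|[set t | (s, t) \in P]|%:R) ->
  #|X|%:R * n <= #|P|%:R.
Proof.
move=> Xn; rewrite mulr_natl -sumr_const; apply: le_trans (ler_sum _ Xn) _.
rewrite -natr_sum ler_nat.
rewrite (eq_bigr (fun s => \sum_(t | (s, t) \in P) 1)%N); last first.
  by move=> s _; rewrite -sum1_card; apply: eq_bigl => t; rewrite inE.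
rewrite pair_big_dep /= sum1dep_card; apply: subset_leq_card.
by apply/subsetP => -[s t]; rewrite inE => /andP[].
Qed.

Section SpanningPairs.
Variables (R : realFieldType) (W : vectType R) (I : finType) (u : I -> W).
Implicit Types (K H M : {vspace W}) (A J Q : {set I}).

(** An instance of the modular law: [K + <[w]>] meets [H] only in [K]. *)
Lemma memv_add_line_out K H w z :
  (K <= H)%VS -> w \notin H -> z \in H -> z \in (K + <[w]>)%VS -> z \in K.
Proof.
move=> /subvP KH wH zH /memv_addP[k kK [_ /vlineP[a ->] zE]].
have [a0|a0] := eqVneq a 0; first by rewrite zE a0 scale0r addr0.
case/negP: wH; have : a *: w \in H by rewrite -(addKr k (a *: w)) -zE memvD // memvN KH.
by rewrite rpredZeq (negbTE a0).
Qed.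

(** Projection from a vector outside [H] is injective on [H], so adding it to the centre identifies
    no two points of [J]. *)
Lemma simple_mod_add K H J w : (K <= H)%VS -> w \notin H ->
  {in J, forall s, u s \in H} -> simple_mod u K J -> simple_mod u (K + <[w]>) J.
Proof.
move=> KH wH JH /simple_modP[J1 J2]; apply/simple_modP; split=> [s sJ|s t sJ tJ st].
  by apply: contra (J1 s sJ); apply: memv_add_line_out (JH s sJ).
apply: contra (J2 s t sJ tJ st); rewrite -addvA [(<[w]> + _)%VS]addvC addvA.
apply: memv_add_line_out (JH t tJ) => //.
by rewrite subv_add KH -memvE JH.
Qed.

(* Pairs such that A has at least t distinct images under projection from the
   line they span. *)
Definition wide_pairs A (t : R) : {set I * I} :=
  [set p in setX A A | (p.1 != p.2) && [exists J : {set I},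
    [&& J \subset A, simple_mod u (<[u p.1]> + <[u p.2]>) J & t <= #|J|%:R]]].

Lemma wide_pairsI A (t : R) s r J : s \in A -> r \in A -> s != r -> J \subset A ->
  simple_mod u (0 + <[u s]> + <[u r]>) J -> t <= #|J|%:R -> (s, r) \in wide_pairs A t.
Proof.
rewrite add0v => sA rA sr JA Js tJ; rewrite !inE /= sA rA sr.
by apply/existsP; exists J; rewrite JA Js.
Qed.

(** * Wide pairs of a non-concentrated set in 3-space *)

Section NonConcentrated.
Variables (alpha : R) (M : {vspace W}) (A : {set I}) (c : nat).
Hypothesis alpha_ge0 : 0 <= alpha.
Hypothesis alpha_lt1 : alpha < 1.
Hypothesis cbig : 24 * 2304 <= c%:R :> R.
Hypothesis dimM : \dim M = 4%N.
Hypothesis AM : {in A, forall s, u s \in M}.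
Hypothesis As : simple_mod u 0 A.
Hypothesis planes : forall H : {vspace W}, (H <= M)%VS -> \dim H = 3%N ->
  #|[set s in A | u s \in H]|%:R <= alpha * #|A|%:R.

Local Notation m := (#|A|%:R : R).
Variables (b : nat) (k : R).
Hypothesis bE : b%:R = 1152 * c%:R :> R.
Hypothesis kE : k * (288 * 1152 * c%:R ^+ 2) = (1 - alpha) ^+ 2.

Let alpha1_ge0 : 0 <= 1 - alpha. Proof. by rewrite subr_ge0 ltW. Qed.

Let alpha1_le1 : 1 - alpha <= 1. Proof. by rewrite gerBl. Qed.

Let c_gt0 : 0 < c%:R :> R. Proof. by apply: lt_le_trans cbig; rewrite mulr_gt0. Qed.

Let c0 : (0 < c)%N. Proof. by rewrite -(ltr0n R). Qed.

Let c_le_sqr : c%:R <= c%:R ^+ 2 :> R.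
Proof. by rewrite expr2 ler_peMl ?ler1n // ltW. Qed.

Let m_ge0 : 0 <= m. Proof. by []. Qed.

Let k_ge0 : 0 <= k.
Proof.
have d0 : 0 < 288 * 1152 * c%:R ^+ 2 :> R by rewrite !mulr_gt0 ?exprn_gt0.
by rewrite -(pmulr_lge0 _ d0) kE exprn_ge0 // subr_ge0 ltW.
Qed.

Let k_le (d : R) : 0 <= d -> d <= 288 * 1152 * c%:R ^+ 2 -> k * d <= 1.
Proof.
move=> d0 dle; apply: le_trans (ler_wpM2l k_ge0 dle) _; rewrite kE.
by rewrite expr_le1.
Qed.

Let off_plane H : (H <= M)%VS -> \dim H = 3%N ->
  (1 - alpha) * m <= #|[set s in A | u s \notin H]|%:R.
Proof.
move=> HM dH; have := planes HM dH => h.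
have : #|[set s in A | u s \in H]|%:R + #|[set s in A | u s \notin H]|%:R = m.
  rewrite -natrD -(cardsID [set s | u s \in H] A); congr ((_ + _)%N%:R).
    by apply: eq_card => s; rewrite !inE.
  by apply: eq_card => s; rewrite !inE andbC.
lra.
Qed.

Let dim2 s t : s \in A -> t \in A -> s != t ->
  \dim (0 + <[u s]> + <[u t]>) = 2%N /\ (0 + <[u s]> + <[u t]> <= M)%VS.
Proof.
have /simple_modP[A1 A2] := As; move=> sA tA st.
rewrite dim_add_line ?A2 // dim_add_line ?A1 // dimv0; split=> //.
by rewrite !subv_add sub0v -!memvE !AM.
Qed.

(** Case of a rich line [L]: for [q] off [L] and [r] off the plane of [L] and [q], the points of [L]
    stay distinct under projection from the line through [q] and [r]. Each choice is open to at
    least [(1 - alpha) m] points. *)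
Let wide_of_line s t : s \in A -> t \in A -> s != t ->
    (#|A| < 288 * b * #|line_mod u 0 A s t|)%N ->
  k * m ^+ 2 <= #|wide_pairs A (k * m)|%:R.
Proof.
move=> sA tA st big; have [dL LM] := dim2 sA tA st.
set L := (_ + _)%VS in dL LM; set J := line_mod u 0 A s t in big.
have JA : J \subset A by apply/subsetP => r; rewrite inE => /andP[].
have JL : {in J, forall r, u r \in L} by move=> r; rewrite inE => /andP[].
have kJ : k * m <= #|J|%:R.
  have : m <= 288 * b%:R * #|J|%:R by rewrite -!natrM ler_nat ltnW.
  move=> /(ler_wpM2l k_ge0)/le_trans; apply.
  rewrite mulrA ler_piMl // k_le ?mulr_ge0 // bE.
  by have := c_le_sqr; lra.
(* Any plane through [L] serves to bound the number of points on [L]. *)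
have [w wM wL] : exists2 w, w \in M & w \notin L.
  by apply/subvPn; apply: contraTN isT => /dimvS; rewrite dimM dL.
have off1 : (1 - alpha) * m <= #|[set q in A | u q \notin L]|%:R.
  have LwM : (L + <[w]> <= M)%VS by rewrite subv_add LM -memvE.
  apply: le_trans (off_plane LwM _) _; first by rewrite dim_add_line ?dL.
  rewrite ler_nat; apply: subset_leq_card; apply/subsetP => q.
  by rewrite !inE => /andP[-> /=]; apply: contra; apply: (subvP (addvSl _ _)).
apply: le_trans (card_fibers_ge (X := [set q in A | u q \notin L]) (n := (1 - alpha) * m) _).
  apply: (@le_trans _ _ ((1 - alpha) * m * ((1 - alpha) * m))).
    rewrite mulrACA -!expr2 ler_wpM2r ?exprn_ge0 // -kE ler_peMr //.
    by have := c_le_sqr; have := cbig; lra.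
  by apply: ler_wpM2r => //; rewrite mulr_ge0 // subr_ge0 ltW.
move=> q; rewrite inE => /andP[qA qL].
have LqM : (L + <[u q]> <= M)%VS by rewrite subv_add LM -memvE AM.
apply: le_trans (off_plane LqM _) _; first by rewrite dim_add_line ?dL.
rewrite ler_nat; apply: subset_leq_card; apply/subsetP => r; rewrite !inE => /andP[rA rLq].
have qr : q != r by apply: contraNneq rLq => <-; rewrite memvE addvSr.
have := @wide_pairsI A (k * m) q r J qA rA qr JA _ kJ; rewrite !inE; apply.
apply: (@simple_mod_add _ (L + <[u q]>)) => //.
- by rewrite addvS // sub0v.
- by move=> z /JL; apply: (subvP (addvSl _ _)).
apply: (@simple_mod_add _ L) => //; first exact: sub0v.
exact: simple_modS As.
Qed.

(** Case of a rich plane but no rich line: [many_centers] in [H] gives points [s] seeing many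
    directions, which remain distinct when a point [r] off [H] joins the centre. *)
Let wide_of_plane H : (H <= M)%VS -> \dim H = 3%N ->
    (#|A| < b * #|[set s in A | u s \in H]|)%N -> 4 * b%:R <= m ->
    {in A &, forall s t, s != t -> (288 * b * #|line_mod u 0 A s t| <= #|A|)%N} ->
  k * m ^+ 2 <= #|wide_pairs A (k * m)|%:R.
Proof.
move=> HM dH big mbig lines; set Q := [set s in A | u s \in H] in big.
have QA : Q \subset A by apply/subsetP => r; rewrite inE => /andP[].
have QH : {in Q, forall r, u r \in H} by move=> r; rewrite inE => /andP[].
have b0 : (0 < b)%N by rewrite -(ltr0n R) bE mulr_gt0.
have bR : 0 < b%:R :> R by rewrite ltr0n.
have bN : m <= b%:R * #|Q|%:R by rewrite -natrM ler_nat ltnW.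
have Q4 : (4 <= #|Q|)%N.
  by rewrite -(ler_nat R) -(ler_pM2l bR); lra.
have [S [SQ QS SJ]] : exists S : {set I}, [/\ S \subset Q, (#|Q| <= 4 * #|S|)%N
    & forall s, s \in S -> exists J : {set I}, [/\ J \subset Q,
        simple_mod u (0 + <[u s]>) J & (#|Q| <= 4 * c * #|J|)%N]].
  apply: many_centers (simple_modS QA As) Q4 cbig _ => s t sQ tQ st.
  have := lines s t (subsetP QA s sQ) (subsetP QA t tQ) st.
  have : (#|line_mod u 0 Q s t| <= #|line_mod u 0 A s t|)%N.
    by apply: subset_leq_card; apply/subsetP => r; rewrite !inE => /andP[/andP[-> _] ->].
  move: #|line_mod u 0 Q s t| #|line_mod u 0 A s t| => x y xy ly.
  rewrite -(leq_pmul2l b0) mulnCA mulnA; apply: leq_trans (ltnW big).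
  exact: leq_trans (leq_mul (leqnn _) xy) ly.
apply: le_trans (card_fibers_ge (X := S) (n := (1 - alpha) * m) _).
  have h : m <= 4 * b%:R * #|S|%:R.
    apply: le_trans bN _; rewrite [4 * _]mulrC -mulrA; apply: ler_wpM2l; first exact: ltW.
    by rewrite -natrM ler_nat.
  rewrite expr2 mulrA [leRHS]mulrA; apply: ler_wpM2r => //.
  apply: le_trans (ler_wpM2l k_ge0 h) _.
  rewrite mulrA mulrC; apply: ler_wpM2l => //.
  apply: (@le_trans _ _ (k * (288 * 1152 * c%:R ^+ 2))).
    apply: ler_wpM2l => //; rewrite bE.
    by have := c_le_sqr; have := c_gt0; lra.
  by rewrite kE expr2 ler_piMl.
move=> s sS; have sQ := subsetP SQ s sS; have sA := subsetP QA s sQ.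
apply: le_trans (off_plane HM dH) _.
rewrite ler_nat; apply: subset_leq_card; apply/subsetP => r; rewrite !inE => /andP[rA rH].
have [J [JQ Js QJ]] := SJ s sS.
have sr : s != r by apply: contraNneq rH => <-; apply: QH.
have := @wide_pairsI A (k * m) s r J sA rA sr (subset_trans JQ QA).
rewrite !inE; apply.
  apply: (@simple_mod_add _ H) => //; first by rewrite subv_add sub0v -memvE QH.
  by move=> z /(subsetP JQ)/QH.
have : m <= 4 * c%:R * b%:R * #|J|%:R.
  apply: le_trans bN _; rewrite -[leRHS]mulrA mulrCA; apply: ler_wpM2l; first exact: ltW.
  by rewrite -!natrM ler_nat.
move=> /(ler_wpM2l k_ge0)/le_trans; apply.
rewrite mulrA ler_piMl //; apply: k_le; first by rewrite !mulr_ge0.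
rewrite bE.
by have := mulr_ge0 (ltW c_gt0) (ltW c_gt0); lra.
Qed.

(** Case of no rich line or plane: [many_centers] gives points [s] seeing many directions [J], and a
    second use, in the projection of [J] from [s], gives the partners [t]. *)
Let wide_of_general : 4 * b%:R <= m ->
    (forall H, (H <= M)%VS -> \dim H = 3%N -> (b * #|[set s in A | u s \in H]| <= #|A|)%N) ->
    {in A &, forall s t, s != t -> (288 * b * #|line_mod u 0 A s t| <= #|A|)%N} ->
  k * m ^+ 2 <= #|wide_pairs A (k * m)|%:R.
Proof.
move=> mbig spread lines; have /simple_modP[A1 A2] := As.
have b0 : (0 < b)%N by rewrite -(ltr0n R) bE mulr_gt0.
(* Since [J] keeps at least [m / (4 c)] points, the bound [m / b] on planes becomes the bound
   [#|J| / 288] that [many_centers] asks for. *)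
have b4 : b = (4 * c * 288)%N.
  by apply/eqP; rewrite -(eqr_nat R) bE !natrM; apply/eqP; ring.
have A4 : (16 * c <= #|A|)%N.
  by rewrite -(ler_nat R) natrM; have := c_gt0; move: mbig; rewrite bE; lra.
have [S [SA AS SJ]] : exists S : {set I}, [/\ S \subset A, (#|A| <= 4 * #|S|)%N
    & forall s, s \in S -> exists J : {set I}, [/\ J \subset A,
        simple_mod u (0 + <[u s]>) J & (#|A| <= 4 * c * #|J|)%N]].
  apply: many_centers As _ cbig _ => [|s t sA tA st].
    exact: leq_trans (leq_mul (isT : (4 <= 16)%N) c0) A4.
  apply: leq_trans (lines s t sA tA st).
  by rewrite leq_mul2r leq_pmulr ?orbT.
have mS : m <= 4 * #|S|%:R by rewrite -natrM ler_nat.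
apply: le_trans (card_fibers_ge (X := S) (n := m / (16 * c%:R)) _).
  rewrite [leRHS]mulrA ler_pdivlMr ?mulr_gt0 //.
  have : k * (64 * c%:R) <= 1.
    apply: k_le; first by rewrite mulr_ge0 ?ltW.
    by have := c_le_sqr; have := c_gt0; lra.
  move=> /(ler_wpM2r (exprn_ge0 2 m_ge0)).
  have := ler_wpM2r m_ge0 mS; rewrite -expr2; lra.
move=> s sS; have sA := subsetP SA s sS; have [J [JA Js AJ]] := SJ s sS.
have /simple_modP[J1 J2] := Js.
have [S' [SJ' JS' S'J]] : exists S' : {set I}, [/\ S' \subset J, (#|J| <= 4 * #|S'|)%N
    & forall t, t \in S' -> exists J' : {set I}, [/\ J' \subset J,
        simple_mod u (0 + <[u s]> + <[u t]>) J' & (#|J| <= 4 * c * #|J'|)%N]].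
  apply: many_centers Js _ cbig _ => [|t r tJ rJ tr].
    rewrite -(@leq_pmul2l (4 * c)) ?muln_gt0 ?c0 //; apply: leq_trans AJ.
    by apply: leq_trans A4; rewrite mulnAC.
  have tA := subsetP JA t tJ; have rA := subsetP JA r rJ.
  (* A line of the projection from [s] comes from a plane [H] through [s], which is poor by
     [spread]. *)
  pose H := (0 + <[u s]> + <[u t]> + <[u r]>)%VS.
  have HM : (H <= M)%VS by rewrite !subv_add sub0v -!memvE !AM.
  have dH : \dim H = 3%N.
    by rewrite !dim_add_line ?J2 ?J1 ?A1 // dimv0.
  have := spread H HM dH.
  have : (#|line_mod u (0 + <[u s]>) J t r| <= #|[set s in A | u s \in H]|)%N.
    apply: subset_leq_card; apply/subsetP => z; rewrite !inE => /andP[/(subsetP JA)-> ->].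
    by [].
  move: #|line_mod _ _ _ _ _| #|[set _ in _ | _]| AJ => x y AJ xy yA.
  rewrite -(@leq_pmul2l (4 * c)) ?muln_gt0 ?c0 //; apply: leq_trans AJ.
  apply: leq_trans yA; rewrite mulnA -b4 leq_mul2l xy orbT.
  by [].
have mS' : m <= 16 * c%:R * #|S'|%:R.
  rewrite -!natrM ler_nat; apply: leq_trans AJ _.
  by apply: leq_trans (leq_mul (leqnn _) JS') _; rewrite mulnA (mulnAC 4 c 4)%N.
apply: (@le_trans _ _ #|S'|%:R).
  by rewrite ler_pdivrMr ?mulr_gt0 // mulrC.
rewrite ler_nat; apply: subset_leq_card; apply/subsetP => t tS'.
have tJ := subsetP SJ' t tS'; have [J' [JJ' Js' JJ'c]] := S'J t tS'.
rewrite inE; apply: (wide_pairsI (J := J')) => //.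
- exact: (subsetP JA).
- by apply: contraNneq (J1 t tJ) => ->; rewrite memvE addvSr.
- exact: subset_trans JJ' JA.
have : m <= 16 * c%:R ^+ 2 * #|J'|%:R.
  rewrite -natrX -!natrM ler_nat; apply: leq_trans AJ _.
  apply: leq_trans (leq_mul (leqnn _) JJ'c) _; apply: eq_leq; ring.
move=> /(ler_wpM2l k_ge0)/le_trans; apply.
rewrite mulrA ler_piMl // k_le // ?mulr_ge0 ?exprn_ge0 //.
by rewrite ler_pM2r ?exprn_gt0 //; lra.
Qed.

(** The three cases combined. The lower bound on [#|A|] ensures that every set to which
    [many_centers] is applied has at least four points. *)
Theorem many_wide_pairs : 4 * 1152 * c%:R <= #|A|%:R :> R ->
  k * #|A|%:R ^+ 2 <= #|wide_pairs A (k * #|A|%:R)|%:R.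
Proof.
move=> mbig0.
have mbig : 4 * b%:R <= m by rewrite bE mulrA.
have [lines|/asboolPn] := pselect
    {in A &, forall s t, s != t -> (288 * b * #|line_mod u 0 A s t| <= #|A|)%N}; last first.
  move=> /asboolPn nl; apply: contra_notP nl => nw s t sA tA st; rewrite leqNgt.
  by apply: contra_notN nw; apply: wide_of_line.
have [spread|ns] := pselect (forall H, (H <= M)%VS -> \dim H = 3%N ->
    (b * #|[set s in A | u s \in H]| <= #|A|)%N).
  exact: wide_of_general.
apply: contra_notP ns => nw H HM dH; rewrite leqNgt.
by apply: contra_notN nw => big; apply: (wide_of_plane HM dH).
Qed.

End NonConcentrated.
End SpanningPairs.

(** * Counting spaces and flats *)

Section CountSpaces.
Variables (R : realFieldType) (W : vectType R) (I : finType) (u : I -> W).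
Variables (alpha : R) (c : nat) (D : {set {set I}}) (r : R).
Hypothesis alpha_ge0 : 0 <= alpha.
Hypothesis alpha_lt1 : alpha < 1.
Hypothesis cbig : 24 * 2304 <= c%:R :> R.
Hypothesis u_simple : simple_mod u 0 [set: I].
Hypothesis r_ge1 : 1 <= r.

Let span (A : {set I}) : {vspace W} := (\sum_(s in A) <[u s]>)%VS.

Hypothesis dim_span : {in D, forall A : {set I}, \dim (span A) = 4%N}.
Hypothesis flat : {in D, forall A : {set I}, A = [set s | u s \in span A]}.
Hypothesis rich : {in D, forall A : {set I}, r <= #|A|%:R}.
Hypothesis planes : {in D, forall (A : {set I}) (H : {vspace W}), (H <= span A)%VS ->
  \dim H = 3%N -> #|[set s in A | u s \in H]|%:R <= alpha * #|A|%:R}.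

Let span_inj : {in D &, injective span}.
Proof. by move=> A B AD BD AB; rewrite (flat AD) (flat BD) AB. Qed.

Let mem_span (A : {set I}) s : s \in A -> u s \in span A.
Proof. by move=> sA; rewrite memvE; apply: (sumv_sup s). Qed.

(** Each member of [D] is recovered from four of its points that span it. *)
Lemma count_spaces_trivial : (#|D| <= #|I| ^ 4)%N.
Proof.
pose G (p : I * I * (I * I)) := [set s | u s \in
  (0 + <[u p.1.1]> + <[u p.1.2]> + <[u p.2.1]> + <[u p.2.2]>)%VS].
suff sub : D \subset [set G p | p in [set: I * I * (I * I)]].
  apply: leq_trans (subset_leq_card sub) (leq_trans (leq_imset_card _ _) _).
  by rewrite cardsT !card_prod !mulnn -expnM.
apply/subsetP => A AD.
have new (H : {vspace W}) : (\dim H < 4)%N -> exists2 s, s \in A & u s \notin H.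
  move=> dH; apply/exists_inP; apply: contraTT dH => /exists_inPn AH.
  rewrite -leqNgt -(dim_span AD); apply: dimvS; apply/subv_sumP => s /AH.
  by rewrite negbK memvE.
have [|p1 A1 n1] := new 0%VS; first by rewrite dimv0.
have d1 := dim_add_line n1; rewrite dimv0 in d1.
have [|p2 A2 n2] := new (0 + <[u p1]>)%VS; first by rewrite d1.
have d2 := dim_add_line n2; rewrite d1 in d2.
have [|p3 A3 n3] := new (0 + <[u p1]> + <[u p2]>)%VS; first by rewrite d2.
have d3 := dim_add_line n3; rewrite d2 in d3.
have [|p4 A4 n4] := new (0 + <[u p1]> + <[u p2]> + <[u p3]>)%VS; first by rewrite d3.
have d4 := dim_add_line n4; rewrite d3 in d4.
apply/imsetP; exists ((p1, p2), (p3, p4)); rewrite ?inE // /G /= {1}(flat AD).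
rewrite (_ : span A = 0 + <[u p1]> + <[u p2]> + <[u p3]> + <[u p4]>)%VS //.
apply/esym/eqP; rewrite eqEdim d4 (dim_span AD) leqnn andbT.
by rewrite !subv_add sub0v -!memvE !mem_span.
Qed.

Variable k : R.
Hypothesis kE : k * (288 * 1152 * c%:R ^+ 2) = (1 - alpha) ^+ 2.
Hypothesis k_gt0 : 0 < k.

(** The spaces containing [p] and [q] have dimension two more than the centre spanned by these, so
    they become lines, and a wide pair supplies at least [k * r] distinct points on each. *)
Let wide_through p q : 2 <= k * r ->
  #|[set A in D | (p, q) \in wide_pairs u A (k * r)]|%:R <=
    2304 * (#|I|%:R ^+ 2 / (k * r) ^+ 3) + 12 * (#|I|%:R / (k * r)) :> R.
Proof.
move=> kr; set D' := [set A in D | _].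
have [->|[A0 A0D]] := set_0Vmem D'.
  have kr0 : 0 <= k * r by lra.
  by rewrite cards0 addr_ge0 // mulr_ge0 // divr_ge0 ?exprn_ge0.
have pq : p != q by move: A0D; rewrite !inE => /andP[_ /andP[_ /andP[]]].
have /simple_modP[u1 u2] := u_simple.
have dK : \dim (<[u p]> + <[u q]>) = 2%N.
  by rewrite -[(<[u p]>)%VS]add0v !dim_add_line ?u2 ?u1 ?inE // dimv0.
rewrite -cardsT; apply: (relative_szemeredi_trotter (u := u) (M := span)
  (K := (<[u p]> + <[u q]>)%VS) (Q := [set: I])) => //.
- by move=> A B; rewrite inE => /andP[AD _]; rewrite inE => /andP[BD _]; apply: span_inj.
- move=> A; rewrite !inE => /andP[AD /andP[/andP[pA qA] _]].
  by rewrite subv_add -!memvE !mem_span //= dK dim_span.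
- move=> A; rewrite inE => /andP[AD]; rewrite inE.
  move=> /andP[_ /andP[_ /existsP[J /and3P[JA Js Jk]]]].
  exists J; rewrite subsetT; split=> // s sJ.
  exact/mem_span/(subsetP JA).
Qed.

Lemma count_spaces_rich : 4 * 1152 * c%:R <= r -> 2 <= k * r ->
  #|D|%:R <= 2304 / k ^+ 4 * (#|I|%:R ^+ 4 * r ^- 5) +
             12 / k ^+ 2 * (#|I|%:R ^+ 3 * r ^- 3).
Proof.
move=> cr kr; have r0 : 0 < r by apply: lt_le_trans r_ge1.
set n := #|I|%:R : R.
pose X := 2304 * (n ^+ 2 / (k * r) ^+ 3) + 12 * (n / (k * r)).
(* Double counting of spaces with a wide pair; the threshold [k * #|A|] is lowered to the common
   value [k * r], so that [wide_through] applies. *)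
have : #|D|%:R * (k * r ^+ 2) <= n ^+ 2 * X.
  apply: (@le_trans _ _ (\sum_(A in D) #|wide_pairs u A (k * r)|%:R)).
    rewrite mulr_natl -sumr_const; apply: ler_sum => A AD.
    have rA := rich AD.
    apply: (@le_trans _ _ (k * #|A|%:R ^+ 2)).
      by rewrite ler_pM2l // lerXn2r ?nnegrE // ltW.
    apply: le_trans (many_wide_pairs (M := span A) alpha_ge0 alpha_lt1 cbig _ _ _ _ (natrM R 1152 c) kE _) _.
    - exact: dim_span.
    - exact: mem_span.
    - exact: simple_modS (subsetT A) u_simple.
    - exact: planes.
    - exact: le_trans cr rA.
    rewrite ler_nat; apply: subset_leq_card; apply/subsetP => p; rewrite !inE.
    move=> /andP[-> /andP[-> /existsP[J /and3P[JA Js Jk]]]] /=.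
    by apply/existsP; exists J; rewrite JA Js (le_trans _ Jk) // ler_pM2l.
  rewrite -natr_sum (eq_bigr (fun A => \sum_p if p \in wide_pairs u A (k * r) then 1 else 0)%N); last first.
    by move=> A _; rewrite -sum1_card big_mkcond.
  rewrite exchange_big natr_sum /= -natrX -[(#|I| ^ 2)%N]mulnn -card_prod.
  rewrite mulr_natl -sumr_const; apply: ler_sum => -[p q] _.
  apply: le_trans (wide_through p q kr); rewrite ler_nat -big_mkcondr sum1dep_card.
  by [].
rewrite -ler_pdivlMr ?mulr_gt0 ?exprn_gt0 // => /le_trans; apply.
rewrite le_eqVlt; apply/orP; left; apply/eqP; rewrite /X; field.
by rewrite !lt0r_neq0.
Qed.

End CountSpaces.

Lemma count_spaces (R : archiRealFieldType) (alpha : R) : 0 <= alpha < 1 ->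
  exists C : R, forall (W : vectType R) (I : finType) (u : I -> W)
      (D : {set {set I}}) (r : R),
    let span (A : {set I}) := (\sum_(s in A) <[u s]>)%VS in
    simple_mod u 0 [set: I] -> 1 <= r ->
    {in D, forall A : {set I}, \dim (span A) = 4%N} ->
    {in D, forall A : {set I}, A = [set s | u s \in span A]} ->
    {in D, forall A : {set I}, r <= #|A|%:R} ->
    {in D, forall (A : {set I}) (H : {vspace W}), (H <= span A)%VS -> \dim H = 3%N ->
       #|[set s in A | u s \in H]|%:R <= alpha * #|A|%:R} ->
  #|D|%:R <= C * (#|I|%:R ^+ 4 * r ^- 5 + #|I|%:R ^+ 3 * r ^- 3).
Proof.
move=> /andP[alpha0 alpha1].
have [c cbig] : exists c : nat, 24 * 2304 <= c%:R :> R.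
  exists (Num.bound (24 * 2304 : R)); apply/ltW/archi_boundP; exact: mulr_ge0.
have c_gt0 : 0 < c%:R :> R by apply: lt_le_trans cbig; rewrite mulr_gt0.
pose q : R := 288 * 1152 * c%:R ^+ 2.
have q_gt0 : 0 < q by rewrite !mulr_gt0 ?exprn_gt0.
pose k := (1 - alpha) ^+ 2 / q.
have kE : k * q = (1 - alpha) ^+ 2 by rewrite mulfVK // lt0r_neq0.
have k_gt0 : 0 < k by rewrite divr_gt0 ?exprn_gt0 // subr_gt0.
(* From [r0] on, both size conditions of [count_spaces_rich] hold. Below it the trivial bound
   [#|I| ^ 4] is absorbed by the summand [r0 ^+ 5] of the constant. *)
clearbody k; pose r0 := 4 * 1152 * c%:R + 2 / k.
have k2 : 0 < 2 / k by rewrite divr_gt0.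
have r0_gt0 : 0 < r0 by rewrite addr_gt0 // !mulr_gt0.
exists (2304 / k ^+ 4 + 12 / k ^+ 2 + r0 ^+ 5).
move=> W I u D r /= us r1 dims flat rich planes.
have r_gt0 : 0 < r by apply: lt_le_trans r1.
have a4 : 0 <= #|I|%:R ^+ 4 * r ^- 5 by rewrite divr_ge0 ?exprn_ge0 // ltW.
have a3 : 0 <= #|I|%:R ^+ 3 * r ^- 3 by rewrite divr_ge0 ?exprn_ge0 // ltW.
have c1 : 0 <= 2304 / k ^+ 4 by rewrite divr_ge0 ?exprn_ge0 // ltW.
have c2 : 0 <= 12 / k ^+ 2 by rewrite divr_ge0 ?exprn_ge0 // ltW.
have c3 : 0 <= r0 ^+ 5 by rewrite exprn_ge0 // ltW.
set x4 := _ * r ^- 5 in a4 *; set x3 := _ * r ^- 3 in a3 *.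
set y1 := 2304 / _ in c1 *; set y2 := 12 / _ in c2 *; set y3 := r0 ^+ 5 in c3 *.
have [big|small] := lerP r0 r.
  have h1 : 4 * 1152 * c%:R <= r by apply: le_trans big; rewrite lerDl ltW.
  have h2 : 2 <= k * r.
    rewrite mulrC -ler_pdivrMr //; apply: le_trans big.
    by rewrite lerDr !mulr_ge0 // ltW.
  apply: le_trans (count_spaces_rich alpha0 alpha1 cbig us r1 dims flat rich planes kE k_gt0 h1 h2) _.
  rewrite -/x4 -/x3 -/y1 -/y2 mulrDr; apply: lerD; apply: ler_wpM2r => //.
    by rewrite -addrA lerDl addr_ge0.
  by rewrite (addrC y1) -addrA lerDl addr_ge0.
apply: (@le_trans _ _ (#|I|%:R ^+ 4)).
  by rewrite -natrX ler_nat; exact: count_spaces_trivial dims flat.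
apply: (@le_trans _ _ (y3 * x4)).
  rewrite /y3 /x4 mulrCA ler_peMr ?exprn_ge0 // ler_pdivlMr ?exprn_gt0 // mul1r.
  by apply: lerXn2r; rewrite ?nnegrE ltW.
rewrite mulrDr; apply: (@le_trans _ _ ((y1 + y2 + y3) * x4)).
  by apply: ler_wpM2r => //; rewrite lerDr addr_ge0.
by rewrite lerDl mulr_ge0 // !addr_ge0.
Qed.

(** * Affine flats as linear spans *)

Section Homogenization.
Variables (R : realFieldType) (d : nat).
Implicit Types (x p w : 'rV[R]_d) (U V : {vspace 'rV[R]_d}).

Definition homog x : 'rV[R]_(1 + d) := row_mx 1%:M x.

Definition at_infinity : 'Hom('rV[R]_d, 'rV[R]_(1 + d)) :=
  linfun (mulmxr (row_mx 0 1%:M)).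

Lemma at_infinityE w : at_infinity w = row_mx 0 w.
Proof. by rewrite lfunE /= mul_mx_row mulmx0 mulmx1. Qed.

(** The linear span of the vectors [(1, x)] for [x] in the flat [p + U]. *)
Definition cone p U : {vspace 'rV[R]_(1 + d)} :=
  (at_infinity @: U + <[homog p]>)%VS.

Lemma homogB x p : homog x - homog p = at_infinity (x - p).
Proof. by rewrite at_infinityE /homog opp_row_mx add_row_mx subrr. Qed.

Lemma mem_cone p U x : (homog x \in cone p U) = (x - p \in U).
Proof.
apply/idP/idP => [/memv_addP[_ /memv_imgP[w wU ->] [_ /vlineP[a ->]]]|xU].
  rewrite at_infinityE /homog scale_row_mx add_row_mx add0r => /eq_row_mx[].
  move=> /matrixP/(_ 0 0); rewrite !mxE /= mulr1 => <-.
  by rewrite scale1r => ->; rewrite addrK.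
rewrite -(subrK (homog p) (homog x)) homogB.
by rewrite memv_add ?memv_img ?memv_line.
Qed.

Lemma homog_notin_infinity p U : homog p \notin (at_infinity @: U)%VS.
Proof.
apply/negP => /memv_imgP[w _]; rewrite at_infinityE => /eq_row_mx[].
by move=> /matrixP/(_ 0 0) /eqP; rewrite !mxE /= oner_eq0.
Qed.

Lemma dim_cone p U : \dim (cone p U) = (\dim U).+1.
Proof.
rewrite dim_add_line ?homog_notin_infinity // limg_dim_eq //.
apply/eqP; rewrite -subv0; apply/subvP => w; rewrite memv_cap memv_ker.
move=> /andP[_ /eqP]; rewrite at_infinityE => /(congr1 rsubmx).
by rewrite row_mxKr linear0 => ->; rewrite mem0v.
Qed.

(** Subtracting from a vector of [H] its first coordinate times [(1, p)] leaves a vector at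
    infinity; hence every subspace through [(1, p)] is the cone of a flat through [p]. *)
Lemma cone_preim p (H : {vspace 'rV[R]_(1 + d)}) :
  homog p \in H -> cone p (at_infinity @^-1: H) = H.
Proof.
move=> pH; apply/eqP; rewrite eqEsubv; apply/andP; split; last first.
  apply/subvP => z zH; pose a := z 0 (lshift d 0).
  have zE : z - a *: homog p = at_infinity (rsubmx z - a *: p).
    rewrite at_infinityE -{1}[z]hsubmxK /homog scale_row_mx opp_row_mx add_row_mx.
    congr row_mx; apply/matrixP => i j; rewrite !mxE !ord1 /= mulr1.
    by rewrite /a; apply/eqP; rewrite subr_eq0; apply/eqP; congr (z _ _); apply: val_inj.
  rewrite -(subrK (a *: homog p) z) memv_add ?rpredZ ?memv_line // zE.
  by apply: memv_img; rewrite -memv_preim -zE memvB // memvZ.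
rewrite subv_add -memvE pH andbT; apply/subvP => _ /memv_imgP[w wH ->].
by rewrite memv_preim.
Qed.

(** A multiple of [(1, x)] with first coordinate 1 is [(1, x)] itself. *)
Lemma homog_simple (I : finType) (v : I -> 'rV[R]_d) : injective v ->
  simple_mod (fun i => homog (v i)) 0 [set: I].
Proof.
move=> v_inj; have nz p : homog p != 0.
  apply: contraTneq (homog_notin_infinity p 0) => ->.
  by rewrite negbK mem0v.
apply/simple_modP; split=> [i _|i j _ _ ij]; first by rewrite memv0.
rewrite add0v; apply: contra ij => /vlineP[a]; rewrite /homog scale_row_mx.
move=> /eq_row_mx[/matrixP/(_ 0 0)]; rewrite !mxE /= mulr1 => <-.
by rewrite scale1r => /v_inj ->.
Qed.

End Homogenization.

From mathcomp Require Import finmap.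
From mathcomp Require Import all_classical all_reals.

(** * From flats to point sets and their spans *)

Section Flats.
Variables (R : realType) (d : nat) (P : {fset 'rV[R]_d}) (alpha r : R).
Hypothesis alpha_ge0 : 0 <= alpha.
Hypothesis alpha_lt1 : alpha < 1.
Hypothesis r_ge1 : 1 <= r.

Let u (i : P) := homog (fsval i).
Let span (A : {set P}) : {vspace 'rV[R]_(1 + d)} := (\sum_(s in A) <[u s]>)%VS.
Let pts (F : set 'rV[R]_d) : {set P} := [set i : P | `[< F (fsval i) >]]%SET.

Let mem_pts F i : (i \in pts F) = `[< F (fsval i) >].
Proof. by rewrite /pts finset.in_set. Qed.

Let nptsE (F : set 'rV[R]_d) : npts P F = #|pts F|.
Proof.
rewrite /npts.
have -> : [fset x in P | x \in F]%fset = [fset fsval i | i in pts F]%fset.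
  apply/fsetP => x; rewrite !inE; apply/andP/imfsetP => [[xP xF]|[i]].
    by exists [` xP]%fset => //=; rewrite mem_pts; apply/asboolP; rewrite -classical_sets.in_setE.
  move=> iF ->; split; first exact: fsvalP.
  by move: iF; rewrite classical_sets.in_setE mem_pts => /asboolP.
rewrite card_imfset /=; last exact: val_inj.
by rewrite cardE.
Qed.

Let mem_pts_cone p (U : {vspace 'rV[R]_d}) : pts [set x | x - p \in U]%classic =
  [set i | u i \in cone p U]%SET.
Proof.
apply/finset.setP => i; rewrite mem_pts finset.in_set mem_cone.
by apply/asboolP/idP.
Qed.

(** If [H] contains some point [i0] of [F], it is the cone of a plane through [i0] inside [F], to
    which the non-concentration condition applies. Otherwise the count is zero. *)
Let pts_planes F : is_flat 3 F -> degenerate P alpha F ->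
  forall p (U : {vspace 'rV[R]_d}), F = [set x | x - p \in U]%classic ->
  forall H : {vspace 'rV[R]_(1 + d)}, (H <= cone p U)%VS -> \dim H = 3%N ->
    #|[set i in pts F | u i \in H]%SET|%:R <= alpha * #|pts F|%:R.
Proof.
move=> F3 deg p U FE H HM dH.
have [->|[i0]] := set_0Vmem [set i in pts F | u i \in H]%SET.
  by rewrite cards0 mulr_ge0.
rewrite finset.in_set => /andP[_ i0H].
pose G : set 'rV[R]_d := [set x | x - fsval i0 \in (@at_infinity R d @^-1: H)%VS]%classic.
have GE x : G x <-> homog x \in H.
  by rewrite /G /= -mem_cone cone_preim.
have G2 : is_flat 2 G.
  exists (fsval i0), (@at_infinity R d @^-1: H)%VS; split=> //.
  by apply/eqP; rewrite -eqSS -(dim_cone (fsval i0)) cone_preim // dH.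
have GF : (G `<=` F)%classic.
  move=> x /GE xH; rewrite FE /= -mem_cone.
  exact: (subvP HM).
have := deg G G2 GF; rewrite !nptsE; apply: le_trans; rewrite ler_nat.
apply: subset_leq_card; apply/fintype.subsetP => i; rewrite finset.in_set => /andP[_ iH].
by rewrite mem_pts; apply/asboolP/GE.
Qed.

(** If the points of [F] failed to span its cone, they would lie in a subspace of dimension 3, which
    would carry all of them rather than a fraction [alpha < 1]; there is at least one since
    [r >= 1]. *)
Let span_pts F p (U : {vspace 'rV[R]_d}) : rich_degenerate_3flats P r alpha F -> \dim U = 3%N ->
  F = [set x | x - p \in U]%classic -> span (pts F) = cone p U.
Proof.
move=> [F3 rich deg] dU FE.
have sub : (span (pts F) <= cone p U)%VS.
  by apply/subv_sumP => i; rewrite FE mem_pts_cone finset.in_set memvE.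
apply/eqP; rewrite eqEdim sub dim_cone dU leqNgt; apply/negP => lt.
have [|H [sH HM dH]] := vspace_extend (n := 3) sub; first by rewrite -ltnS lt dim_cone dU.
have := pts_planes F3 deg FE HM dH.
have -> : [set i in pts F | u i \in H]%SET = pts F.
  apply/finset.setP => i; rewrite finset.in_set; case iF: (i \in pts F) => //=.
  by apply: (subvP sH); rewrite memvE; apply: (sumv_sup i).
have : 1 <= #|pts F|%:R :> R by rewrite -nptsE; apply: le_trans r_ge1 rich.
move=> m1; have m0 : 0 < #|pts F|%:R :> R by apply: lt_le_trans m1.
by rewrite ler_pMl // leNgt alpha_lt1.
Qed.

(** A counted flat is recovered from its point set by [flat_of], so [D] is at least as large as the
    family of flats, and that family is finite. *)
Let D : {set {set P}} :=
  [set A | `[< exists2 F, rich_degenerate_3flats P r alpha F & A = pts F >]]%SET.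

Let flat_of (A : {set P}) : set 'rV[R]_d := [set x | homog x \in span A]%classic.

Let flat_of_pts F : rich_degenerate_3flats P r alpha F -> flat_of (pts F) = F.
Proof.
move=> FR; have [[p [U [dU FE]]] _ _] := FR.
rewrite /flat_of (span_pts FR dU FE) [RHS]FE.
by apply/seteqP; split=> x /=; rewrite mem_cone.
Qed.

Let flats_sub : (rich_degenerate_3flats P r alpha `<=` flat_of @` [set` D])%classic.
Proof.
move=> F FR; exists (pts F); last exact: flat_of_pts.
by rewrite /= finset.in_set; apply/asboolP; exists F.
Qed.

Lemma finite_rich_degenerate : finite_set (rich_degenerate_3flats P r alpha).
Proof.
apply: sub_finite_set flats_sub _; apply: finite_image; exact: finite_finset.
Qed.

Lemma card_rich_degenerate :
  (#|` fset_set (rich_degenerate_3flats P r alpha)| <= #|D|)%N.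
Proof.
have sub : (fset_set (rich_degenerate_3flats P r alpha) `<=` [fset flat_of A | A in D])%fset.
  apply/fsubsetP => F; rewrite in_fset_set; last exact: finite_rich_degenerate.
  rewrite classical_sets.in_setE => /flats_sub[A AD <-]; apply/imfsetP; exists A => //.
apply: leq_trans (fsubset_leq_card sub) _.
by apply: leq_trans (leq_imfset_card _ _ _) _; rewrite cardE.
Qed.

Let D_ex A : A \in D -> exists F p (U : {vspace 'rV[R]_d}),
  [/\ rich_degenerate_3flats P r alpha F, A = pts F, \dim U = 3%N,
      F = [set x | x - p \in U]%classic & span A = cone p U].
Proof.
rewrite finset.in_set => /asboolP[F FR AE]; have [[p [U [dU FE]]] _ _] := FR.
by exists F, p, U; rewrite AE (span_pts FR dU FE).
Qed.

Lemma rich_degenerate_spaces : exists E : {set {set P}},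
  [/\ (#|` fset_set (rich_degenerate_3flats P r alpha)| <= #|E|)%N,
      {in E, forall A : {set P}, \dim (span A) = 4%N},
      {in E, forall A : {set P}, A = [set i | u i \in span A]%SET},
      {in E, forall A : {set P}, r <= #|A|%:R} &
      {in E, forall (A : {set P}) (H : {vspace _}), (H <= span A)%VS ->
         \dim H = 3%N -> #|[set i in A | u i \in H]%SET|%:R <= alpha * #|A|%:R}].
Proof.
exists D; split; first exact: card_rich_degenerate.
- by move=> A /D_ex[F [p [U [_ _ dU _ ->]]]]; rewrite dim_cone dU.
- by move=> A /D_ex[F [p [U [_ AE _ FE ->]]]]; rewrite AE FE mem_pts_cone.
- by move=> A /D_ex[F [p [U [[_ rich _] -> _ _ _]]]]; rewrite -nptsE.
- move=> A /D_ex[F [p [U [[F3 _ deg] -> _ FE ->]]]]; exact: pts_planes FE.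
Qed.

End Flats.

Local Open Scope fset_scope.
Local Open Scope classical_set_scope.
Local Open Scope ring_scope.

Theorem theorem10 (R : realType) (alpha : R) (halpha : 0 <= alpha < 1) :
  exists C : R,
    forall (d n : nat) (P : {fset 'rV[R]_d}) (r : R),
      #|` P| = n -> 1 <= r ->
      finite_set (rich_degenerate_3flats P r alpha) /\
      #|` fset_set (rich_degenerate_3flats P r alpha)|%:R
        <= C * (n%:R ^+ 4 * r ^- 5 + n%:R ^+ 3 * r ^- 3).
Proof.
have /andP[alpha0 alpha1] := halpha.
have [C count] := count_spaces halpha.
exists C => d n P r nP r1; split; first exact: finite_rich_degenerate.
have [E [cardE dimE flatE richE planesE]] :=
  rich_degenerate_spaces P alpha0 alpha1 r1.
rewrite -nP (cardfE P).
apply: le_trans (count _ _ _ E r (homog_simple val_inj) r1 dimE flatE richE planesE).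
by rewrite ler_nat.
Qed.
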